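(* Let a slow scalar mode $q(t)$ be coupled to a bath of $N$ harmonic oscillators with coordinates $x_k(t)$, frequencies $\omega_k>0$ and coupling constants $g_k\in\mathbb{R}$, $k=1,\dots,N$, through the Hamiltonian \[ H_N=\tfrac12\dot q^2+\sum_{k=1}^N\Big[\tfrac12\dot x_k^2+\tfrac12\omega_k^2\Big(x_k-\frac{g_k}{\omega_k^2}\,q\Big)^2\Big]. \] Then elimination of the bath variables yields the exact generalized Langevin equation \[ \ddot q(t)=-\int_0^t K_N(t-s)\,\dot q(s)\,\mathrm{d}s+\eta_N(t),\qquad K_N(t)=\sum_{k=1}^N\frac{g_k^2}{\omega_k^2}\cos(\omega_k t), \] where, in thermal equilibrium at temperature $T$, $\eta_N$ is a stationary Gaussian process with covariance $\langle\eta_N(t),\eta_N(0)\rangle=k_BT\,K_N(t)$. Moreover, if the couplings are distributed so that the measures $\tfrac{\pi}{2}\sum_{k}(g_k^2/\omega_k^2)\,\delta(\omega-\omega_k)$ converge weakly to $\frac{J(\omega)}{\omega}\,\mathrm{d}\omega$ as $N\to\infty$, then \[ K_N(t)\to K(t):=\frac{2}{\pi}\int_0^\infty\frac{J(\omega)}{\omega}\cos(\omega t)\,\mathrm{d}\omega , \] and the force covariance, normalized by $k_BT$, converges to $K(t)$.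
   Context: The dynamics are Hamilton's equations of $H_N$ (unit masses, momenta $\dot q,\dot x_k$). The residual force $\eta_N$ collects the terms carrying the initial bath data $x_k(0),\dot x_k(0)$ (and the initial position $q(0)$ through the shift $x_k(0)-g_kq(0)/\omega_k^2$). ''Thermal equilibrium'' means that the initial bath data are drawn from the Gibbs measure proportional to $e^{-H_N/(k_BT)}$, with $q(0)$ given; $\langle\cdot,\cdot\rangle$ is the covariance under this measure and $k_B$ is Boltzmann's constant. $J\ge 0$ is a spectral density on $(0,\infty)$. *)

(* Defs.v *)
From HB Require Import structures.
From mathcomp Require Import all_boot all_order all_algebra.
From mathcomp Require Import all_classical all_reals all_analysis.

Set Implicit Arguments.
Unset Strict Implicit.
Unset Printing Implicit Defensive.

Import Order.TTheory GRing.Theory Num.Theory.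
Import numFieldNormedType.Exports.

Local Open Scope classical_set_scope.
Local Open Scope ring_scope.

(** ** Lebesgue measure on R^n *)

(* The product of Lebesgue measure on R with a measure m on R^n, carried to
   R^(n+1) by (x, v) |-> x :: v. *)
Definition lebesgue_cons (R : realType) (n : nat)
    (m : {sigma_finite_measure set (n.-tuple (measurableTypeR R)) -> \bar R})
    : set (n.+1.-tuple (measurableTypeR R)) -> \bar R :=
  pushforward (@lebesgue_measure R \x m)%E
    (fun z => [the n.+1.-tuple (measurableTypeR R) of z.1 :: z.2]).

Section lebesgue_cons_measure.
Context (R : realType) (n : nat)
  (m : {sigma_finite_measure set (n.-tuple (measurableTypeR R)) -> \bar R}).

Let cons_tuple := fun z : measurableTypeR R * n.-tuple (measurableTypeR R) =>
  [the n.+1.-tuple (measurableTypeR R) of z.1 :: z.2].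

Let measurable_cons_tuple : measurable_fun setT cons_tuple.
Proof. by apply: measurable_cons. Qed.

Let lebesgue_cons0 : lebesgue_cons m set0 = 0%E.
Proof. by rewrite /lebesgue_cons /pushforward preimage_set0 measure0. Qed.

Let lebesgue_cons_ge0 A : (0 <= lebesgue_cons m A)%E.
Proof. exact: measure_ge0. Qed.

Let lebesgue_cons_sigma_additive : semi_sigma_additive (lebesgue_cons m).
Proof.
exact: (@measure_semi_sigma_additive _ _ _
  (pushforward (@lebesgue_measure R \x m)%E cons_tuple
     : {measure set _ -> \bar R})).
Qed.

HB.instance Definition _ := isMeasure.Build _ _ _ (lebesgue_cons m)
  lebesgue_cons0 lebesgue_cons_ge0 lebesgue_cons_sigma_additive.

Let lebesgue_cons_sigma_finite : sigma_finite setT (lebesgue_cons m).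
Proof.
have /sigma_finiteP[F [TF ndF Foo]] := sigma_finiteT (@lebesgue_measure R).
have /sigma_finiteP[G [TG ndG Goo]] := sigma_finiteT m.
pose split_tuple := fun t : n.+1.-tuple (measurableTypeR R) =>
  (thead t, [tuple of behead t]).
have msplit : measurable_fun setT split_tuple.
  apply: measurable_fun_pair; first exact: measurable_tnth.
  exact: measurable_behead.
have consK z : split_tuple (cons_tuple z) = z.
  by case: z => a v; rewrite /split_tuple /cons_tuple /=; congr pair; exact/val_inj.
exists (fun k => split_tuple @^-1` (F k `*` G k)).
  apply/esym; rewrite -subTset => t _.
  have [i _ Fi] : (\bigcup_k F k) (thead t) by rewrite -TF.
  have [j _ Gj] : (\bigcup_k G k) [tuple of behead t] by rewrite -TG.
  exists (maxn i j) => //; split.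
    by move: Fi; exact/subsetPset/ndF/leq_maxl.
  by move: Gj; exact/subsetPset/ndG/leq_maxr.
move=> k; have [mF Fk] := Foo k; have [mG Gk] := Goo k; split.
  by rewrite -[X in measurable X]setTI; apply: msplit => //; exact: measurableX.
rewrite [ltLHS](_ : _ = (@lebesgue_measure R \x m)%E (F k `*` G k)).
  by rewrite product_measure1E// lte_mul_pinfty// ge0_fin_numE.
congr product_measure1.
rewrite -/cons_tuple -comp_preimage (_ : split_tuple \o cons_tuple = id)//.
exact/funext.
Qed.

HB.instance Definition _ := Measure_isSigmaFinite.Build _ _ _
  (lebesgue_cons m) lebesgue_cons_sigma_finite.

End lebesgue_cons_measure.

Fixpoint lebesgue_tuple (R : realType) (n : nat)
    : {sigma_finite_measure set (n.-tuple (measurableTypeR R)) -> \bar R} :=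
  match n with
  | 0 => @dirac _ (0.-tuple (measurableTypeR R)) [tuple] R
  | n'.+1 => lebesgue_cons (lebesgue_tuple R n')
  end.

(* Points (x, v) of R^N x R^N: bath coordinates and bath velocities. *)
Notation phase_space R N :=
  (N.-tuple (measurableTypeR R) * N.-tuple (measurableTypeR R))%type.

(** ** The oscillator bath *)

(* p is the momentum of q and v k the momentum of x k (unit masses). *)
Definition hamiltonian (R : realType) (N : nat) (g om : 'I_N -> R)
    (q p : R) (x v : 'I_N -> R) : R :=
  p ^+ 2 / 2 +
  \sum_(k < N) (v k ^+ 2 / 2 +
                om k ^+ 2 * (x k - g k / om k ^+ 2 * q) ^+ 2 / 2).

Definition hamilton_equations (R : realType) (N : nat) (g om : 'I_N -> R)
    (q p : R -> R) (x v : 'I_N -> R -> R) : Prop :=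
  let H := hamiltonian g om in
  forall t : R,
  [/\ is_derive t 1 q ((fun z => H (q t) z (x ^~ t) (v ^~ t))^`()%classic (p t)),
      is_derive t 1 p (- (fun z => H z (p t) (x ^~ t) (v ^~ t))^`()%classic (q t)),
      forall k, is_derive t 1 (x k)
        ((fun z => H (q t) (p t) (x ^~ t) [eta v ^~ t with k |-> z])^`()%classic
           (v k t)) &
      forall k, is_derive t 1 (v k)
        (- (fun z => H (q t) (p t) [eta x ^~ t with k |-> z] (v ^~ t))^`()%classic
           (x k t))].

Definition memory_kernel (R : realType) (N : nat) (g om : 'I_N -> R) (t : R)
    : R :=
  \sum_(k < N) g k ^+ 2 / om k ^+ 2 * cos (om k * t).

(* The k-th summand is g k times the free evolution, with frequency om k, of
   the displacement x k - g k / om k ^+ 2 * q from its initial value, q being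
   frozen at q0. *)
Definition residual_force (R : realType) (N : nat) (g om : 'I_N -> R)
    (q0 : R) (x0 v0 : 'I_N -> R) (t : R) : R :=
  \sum_(k < N) g k * ((x0 k - g k / om k ^+ 2 * q0) * cos (om k * t) +
                      v0 k / om k * sin (om k * t)).

(* mu is proportional to exp (- H / kT) dx dv on R^N x R^N, with the initial
   position q0 and momentum p0 of the slow mode given; when mu is a
   probability measure, c is the inverse of the partition function. *)
Definition gibbs_law (R : realType) (N : nat) (g om : 'I_N -> R)
    (kT q0 p0 : R) (mu : set (phase_space R N) -> \bar R) : Prop :=
  exists c : R, forall A, measurable A ->
    mu A = (c%:E *
      \int[lebesgue_tuple R N \x lebesgue_tuple R N]_(z in A)
        (expR (- hamiltonian g om q0 p0 (tnth z.1) (tnth z.2) / kT))%:E)%E.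

(* The residual force as a process on the sample space T of the initial bath
   data Z. *)
Definition force_process (R : realType) (N : nat) (g om : 'I_N -> R) (q0 : R)
    (T : Type) (Z : T -> phase_space R N) (t : R) (w : T) : R :=
  residual_force g om q0 (tnth (Z w).1) (tnth (Z w).2) t.

(** ** Gaussian and stationary processes *)

(* Degenerate Gaussians are included; they are listed separately because
   normal_prob m 0 is not a point mass. *)
Definition gaussian_variable (d : measure_display) (T : measurableType d)
    (R : realType) (P : probability T R) (Y : T -> R) : Prop :=
  measurable_fun [set: T] Y /\
  ((exists m : R, forall A : set (measurableTypeR R), measurable A ->
      P (Y @^-1` A) = \d_m A) \/
   (exists m s : R, 0 < s /\ forall A : set (measurableTypeR R), measurable A ->
      P (Y @^-1` A) = normal_prob m s A)).

(* All finite-dimensional marginals are Gaussian vectors, i.e. have Gaussian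
   linear combinations. *)
Definition gaussian_process (d : measure_display) (T : measurableType d)
    (R : realType) (P : probability T R) (X : R -> T -> R) : Prop :=
  forall (n : nat) (t a : 'I_n -> R),
    gaussian_variable P (fun w => \sum_(i < n) a i * X (t i) w).

Definition stationary_process (d : measure_display) (T : measurableType d)
    (R : realType) (P : probability T R) (X : R -> T -> R) : Prop :=
  forall (n : nat) (t : 'I_n -> R) (h : R)
    (A : set (n.-tuple (measurableTypeR R))), measurable A ->
    P [set w | A [tuple X (t i + h) w | i < n]] =
    P [set w | A [tuple X (t i) w | i < n]].

(** ** Weak convergence to a spectral measure *)

Definition weak_cvg (R : realType)
    (mu : nat -> set (measurableTypeR R) -> \bar R)
    (nu : set (measurableTypeR R) -> \bar R) : Prop :=
  forall f : R -> R, continuous f -> (exists M, forall x, `|f x| <= M) ->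
    (\int[mu n]_x (f x)%:E)%E @[n --> \oo] --> (\int[nu]_x (f x)%:E)%E.

Definition bath_measure (R : realType) (N : nat) (g om : 'I_N -> R)
    (A : set (measurableTypeR R)) : \bar R :=
  (\sum_(k < N) (pi / 2 * (g k ^+ 2 / om k ^+ 2))%:E * \d_(om k) A)%E.

(* J(w)/w dw on (0, +oo), as a measure on R. *)
Definition spectral_measure (R : realType) (J : R -> R)
    (A : set (measurableTypeR R)) : \bar R :=
  (\int[lebesgue_measure]_(w in A `&` `]0%R, +oo[) (J w / w)%:E)%E.

Definition limit_kernel (R : realType) (J : R -> R) (t : R) : R :=
  2 / pi * \int[lebesgue_measure]_(w in `]0, +oo[) (J w / w * cos (w * t)).

(* Main.v *)
(* The force that the bath would exert at time t if the slow mode were frozen from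
   time s on is the residual force at s = 0 and the actual force at s = t; its
   derivative in s is - K_N (t - s) q'(s), so integrating over [0, t] gives the
   Langevin equation.

   The residual force at time t + h is the residual force at time t evaluated on
   the bath data rotated by the angles om k * h in the planes
   (om k (x k - g k q / om k ^ 2), v k). Such rotations preserve Lebesgue measure,
   being products of shears, and they preserve the Hamiltonian, hence the Gibbs
   law: this is stationarity. Linear combinations of values of the force are linear
   forms in the bath data; under the Gibbs law these are sums of independent
   centred Gaussians, hence Gaussian with an explicit variance, which gives the
   covariance by polarization.

   Finally K_N(t) is 2 / pi times the integral of cos (w t) against the bath
   measure, and weak convergence applies to the nonnegative bounded continuous
   functions 1 + cos (w t) and 1. *)

Require Import Defs.
From HB Require Import structures.
From mathcomp Require Import all_boot all_order all_algebra.
From mathcomp Require Import all_classical all_reals all_analysis.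
From mathcomp Require Import measurable_realfun ring lra.

Set Implicit Arguments.
Unset Strict Implicit.
Unset Printing Implicit Defensive.

Import Order.TTheory GRing.Theory Num.Theory.
Import numFieldNormedType.Exports.

Local Open Scope classical_set_scope.
Local Open Scope ring_scope.

(** * Integration against a measure given by a density *)

Section density.
Local Open Scope ereal_scope.
Context d (T : measurableType d) (R : realType).
Variables (mu : {measure set T -> \bar R}) (h : T -> R).
Hypotheses (mh : measurable_fun setT h) (h0 : forall x, (0 <= h x)%R).

Import HBNNSimple.

(** The hypothesis settles indicators, linearity settles nonnegative simple functions, and monotone
    convergence along increasing simple approximations of [f] does the rest. *)
Lemma ge0_integral_density (nu : {measure set T -> \bar R}) (f : T -> \bar R) :
  (forall A, measurable A -> nu A = \int[mu]_(x in A) (h x)%:E) ->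
  measurable_fun setT f -> (forall x, 0 <= f x) ->
  \int[nu]_x f x = \int[mu]_x (f x * (h x)%:E).
Proof.
move=> nuE mf f0; pose f_ := nnsfun_approx measurableT mf.
have f_cvg x : EFin \o f_ ^~ x @ \oo --> f x.
  by apply: cvg_nnsfun_approx => //.
have f_nd x m n : (m <= n)%N -> (f_ m x <= f_ n x)%R.
  by move=> mn; exact/lefP/nd_nnsfun_approx.
transitivity (limn (fun n => \int[nu]_x (f_ n x)%:E)).
  rewrite -monotone_convergence//.
  - by apply: eq_integral => y _; apply/esym/cvg_lim => //; exact: f_cvg.
  - by move=> n; exact/measurable_EFinP/measurable_funP.
  - by move=> n y _; rewrite lee_fin.
  - by move=> y _ m n mn; rewrite lee_fin f_nd.
transitivity (limn (fun n => \int[mu]_x ((f_ n x)%:E * (h x)%:E))); last first.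
  rewrite -monotone_convergence//.
  - apply: eq_integral => y _; apply/cvg_lim => //.
    by apply: cvgeZr => //; exact: f_cvg.
  - by move=> n; apply/measurable_EFinP/measurable_funM.
  - by move=> n y _; rewrite lee_fin mulr_ge0.
  - by move=> y _ m n mn; rewrite lee_fin ler_wpM2r// f_nd.
congr (limn _); apply/funext => n.
have mA r : measurable (f_ n @^-1` [set r]).
  by rewrite -[X in measurable X]setTI; exact: measurable_funP.
under eq_integral do rewrite fimfunE -fsumEFin//.
rewrite ge0_integral_fsum//; last 2 first.
- by move=> y; exact/measurable_EFinP/measurable_funM.
- by move=> y x _; rewrite nnfun_muleindic_ge0.
under [RHS]eq_integral.
  move=> x _; rewrite fimfunE -fsumEFin// ge0_mule_fsuml; last first.
    by move=> r; rewrite EFinM nnfun_muleindic_ge0.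
  over.
rewrite ge0_integral_fsum//; last 2 first.
- move=> y; apply/measurable_EFinP/measurable_funM => //.
  exact/measurable_funM.
- move=> y x _; apply: mule_ge0; last by rewrite lee_fin.
  by rewrite EFinM nnfun_muleindic_ge0.
apply: eq_fsbigr => r _; rewrite integralZl_indic_nnsfun// integral_indic//=.
rewrite setIT nuE//.
transitivity (\int[mu]_x (r%:E * (h x * \1_(f_ n @^-1` [set r]) x)%:E)); last first.
  by apply: eq_integral => x _; rewrite -!EFinM mulrCA mulrC.
(* A nonnegative simple function has empty level sets at negative values, so for [r < 0] both sides
   vanish. *)
have [r0|r0] := leP 0%R r.
  rewrite ge0_integralZl//; last 2 first.
  - by apply/measurable_EFinP/measurable_funM.
  - by move=> x _; rewrite lee_fin mulr_ge0.
  congr (_ * _); rewrite integral_mkcond; apply: eq_integral => x _.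
  by rewrite patchE indicE; case: ifPn => _; rewrite ?(mulr1, mulr0).
by rewrite preimage_nnfun0// integral_set0 mule0 integral0_eq// => x _;
  rewrite indic0 mulr0 mule0.
Qed.

End density.

(** * Affine changes of variable on the line *)

Section lebesgue_change_of_variables.
Local Open Scope ereal_scope.
Context {R : realType}.
Local Notation mu := (@lebesgue_measure R).

(** The image of Lebesgue measure under the affine map, scaled by the Jacobian [s], gives half-open
    intervals their length, so it is Lebesgue measure by uniqueness. *)
Lemma ge0_integral_lebesgue_affine (f : R -> \bar R) (m s : R) : (0 < s)%R ->
  measurable_fun setT f -> (forall x, 0 <= f x) ->
  s%:E * \int[mu]_x f (m + s * x)%R = \int[mu]_x f x.
Proof.
move=> s0 mf f0.
have maff : measurable_fun [set: measurableTypeR R]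
    (fun x : R => m + s * x : measurableTypeR R)%R.
  by apply: measurable_funD => //; exact: measurable_funM.
pose aff (x : measurableTypeR R) : measurableTypeR R := (m + s * x)%R.
pose nu_ : {measure set (measurableTypeR R) -> \bar R} :=
  mscale (NngNum (ltW s0)) (pushforward mu aff).
pose nu := nu_ maff.
have nuE A : measurable A -> mu A = nu A.
  apply: lebesgue_measure_unique => _ [[a b]] _ <-.
  rewrite -[RHS]/(s%:E * mu (aff @^-1` `]a, b])).
  rewrite (_ : aff @^-1` _ = `](a - m) / s, (b - m) / s]%classic)%R; last first.
    apply/seteqP; split=> x; rewrite /aff/= !in_itv/= ltr_pdivrMr// ler_pdivlMr//;
      by rewrite ltrBlDl lerBrDl mulrC.
  rewrite !lebesgue_measure_itv/= !lte_fin ltr_pM2r ?invr_gt0// ltrD2r.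
  case: ifPn => _; last by rewrite mule0.
  rewrite -!EFinB -EFinM; congr (_%:E); rewrite -mulrBl mulrCA divff ?gt_eqF//.
  by rewrite mulr1; ring.
transitivity (\int[nu]_x f x); last by apply: eq_measure_integral => A mA _; apply/esym/nuE.
by rewrite /nu /nu_ ge0_integral_mscale// ge0_integral_pushforward.
Qed.

Lemma ge0_integral_lebesgue_shift (f : R -> \bar R) (a : R) :
  measurable_fun setT f -> (forall x, 0 <= f x) ->
  \int[mu]_x f (x + a)%R = \int[mu]_x f x.
Proof.
move=> mf f0; rewrite -(@ge0_integral_lebesgue_affine f a 1)// mul1e.
by apply: eq_integral => x _; rewrite mul1r addrC.
Qed.

End lebesgue_change_of_variables.

(** * Shears of a product space *)

Section shear.
Local Open Scope ereal_scope.
Context d1 d2 (T1 : measurableType d1) (T2 : measurableType d2) (R : realType).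
Variables (m1 : {sigma_finite_measure set T1 -> \bar R})
  (m2 : {sigma_finite_measure set T2 -> \bar R}).

(** Tonelli integrates the moved coordinate first, with the other one frozen, so invariance of [m1]
    on each fibre suffices. *)
Lemma ge0_integral_shear1 (phi : T2 -> T1 -> T1) (f : T1 * T2 -> \bar R) :
  measurable_fun setT (fun z => phi z.2 z.1) ->
  (forall y (g : T1 -> \bar R), measurable_fun setT g -> (forall x, 0 <= g x) ->
    \int[m1]_x g (phi y x) = \int[m1]_x g x) ->
  measurable_fun setT f -> (forall z, 0 <= f z) ->
  \int[m1 \x m2]_z f (phi z.2 z.1, z.2) = \int[m1 \x m2]_z f z.
Proof.
move=> mphi phiE mf f0.
have mf' : measurable_fun setT (fun z => f (phi z.2 z.1, z.2)).
  by apply: (measurableT_comp mf); apply: measurable_fun_pair.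
apply: etrans (fubini_tonelli2 _ mf' (fun z => f0 _)) _.
apply: etrans _ (esym (fubini_tonelli2 f mf f0)).
  apply: eq_integral => y _; rewrite /fubini_G/=.
  by rewrite (phiE y (fun x => f (x, y)))//; exact: measurableT_comp.
Qed.

Lemma ge0_integral_shear2 (phi : T1 -> T2 -> T2) (f : T1 * T2 -> \bar R) :
  measurable_fun setT (fun z => phi z.1 z.2) ->
  (forall x (g : T2 -> \bar R), measurable_fun setT g -> (forall y, 0 <= g y) ->
    \int[m2]_y g (phi x y) = \int[m2]_y g y) ->
  measurable_fun setT f -> (forall z, 0 <= f z) ->
  \int[m1 \x m2]_z f (z.1, phi z.1 z.2) = \int[m1 \x m2]_z f z.
Proof.
move=> mphi phiE mf f0.
have mf' : measurable_fun setT (fun z => f (z.1, phi z.1 z.2)).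
  by apply: (measurableT_comp mf); apply: measurable_fun_pair.
apply: etrans (fubini_tonelli1 _ mf' (fun z => f0 _)) _.
apply: etrans _ (esym (fubini_tonelli1 f mf f0)).
  apply: eq_integral => x _; rewrite /fubini_F/=.
  by rewrite (phiE x (fun y => f (x, y)))//; exact: measurableT_comp.
Qed.

End shear.

(** * Lebesgue measure on tuples: Tonelli and translation invariance *)

Section lebesgue_tuple.
Local Open Scope ereal_scope.
Context {R : realType}.

Lemma ge0_integral_lebesgue_tupleS n (f : n.+1.-tuple (measurableTypeR R) -> \bar R) :
  measurable_fun setT f -> (forall t, 0 <= f t) ->
  \int[lebesgue_tuple R n.+1]_t f t =
  \int[@lebesgue_measure R]_x \int[lebesgue_tuple R n]_t f [tuple of x :: t].
Proof.
move=> mf f0; pose cons_t (z : measurableTypeR R * n.-tuple (measurableTypeR R)) :=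
  [the n.+1.-tuple (measurableTypeR R) of z.1 :: z.2].
have mcons : measurable_fun setT cons_t by exact: measurable_cons.
transitivity (\int[@lebesgue_measure R \x lebesgue_tuple R n]_z f (cons_t z)).
  exact: (ge0_integral_pushforward mcons (@lebesgue_measure R \x lebesgue_tuple R n)
    measurableT mf).
apply: (fubini_tonelli1 (f \o cons_t)).
  exact: (measurableT_comp mf mcons).
by move=> z; exact: f0.
Qed.

Definition add_tuple n (a t : n.-tuple (measurableTypeR R)) : n.-tuple (measurableTypeR R) :=
  [tuple (tnth t i + tnth a i)%R | i < n].

Lemma measurable_add_tuple d (T : measurableType d) n
    (f g : T -> n.-tuple (measurableTypeR R)) :
  measurable_fun setT f -> measurable_fun setT g ->
  measurable_fun setT (fun x => add_tuple (f x) (g x)).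
Proof.
move=> /measurable_fun_tnthP mf /measurable_fun_tnthP mg.
apply/measurable_fun_tnthP => i.
rewrite (_ : _ \o _ = fun x => tnth (g x) i + tnth (f x) i)%R; last first.
  by apply/funext => x /=; rewrite tnth_mktuple.
by apply: measurable_funD; [exact: mg|exact: mf].
Qed.

(** Induction on the dimension: the tail is translated by the induction hypothesis at a fixed head,
    then the head by the one-dimensional shift. *)
Lemma ge0_integral_lebesgue_tuple_shift n (a : n.-tuple (measurableTypeR R))
    (f : n.-tuple (measurableTypeR R) -> \bar R) :
  measurable_fun setT f -> (forall t, 0 <= f t) ->
  \int[lebesgue_tuple R n]_t f (add_tuple a t) = \int[lebesgue_tuple R n]_t f t.
Proof.
elim: n => [|n IH] in a f *.
  move=> mf f0; apply: eq_integral => t _.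
  by rewrite [t]tuple0 [add_tuple _ _]tuple0.
move=> mf f0.
have mtl x : measurable_fun setT (fun t : n.-tuple (measurableTypeR R) =>
    [the n.+1.-tuple (measurableTypeR R) of x :: t]).
  by apply: measurable_cons.
have maddl : measurable_fun setT (add_tuple a).
  exact: measurable_add_tuple.
have := ge0_integral_lebesgue_tupleS (measurableT_comp mf maddl) (fun t => f0 _).
move=> /= ->; rewrite (ge0_integral_lebesgue_tupleS mf f0).
pose F x := \int[lebesgue_tuple R n]_t f [tuple of x :: t].
transitivity (\int[@lebesgue_measure R]_x F (x + thead a)%R).
  apply: eq_integral => x _; rewrite /F.
  rewrite -(IH [tuple of behead a] _ (measurableT_comp mf (mtl _)))/=; last first.
    by move=> t; exact: f0.
  apply: eq_integral => t _; congr f.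
  apply: eq_from_tnth => i; rewrite tnth_mktuple.
  case: (unliftP ord0 i) => [j ->|->]; last by rewrite !tnth0.
  by rewrite !tnthS tnth_mktuple tnth_behead (_ : inord j.+1 = lift ord0 j)//;
    apply/val_inj; rewrite /= inordK// ltnS.
rewrite ge0_integral_lebesgue_shift// => [|x]; last exact: integral_ge0.
(* What remains is measurability of the partial integral [F], which Tonelli gives for
   [f \o cons_t]. *)
pose cons_t (z : measurableTypeR R * n.-tuple (measurableTypeR R)) :=
  [the n.+1.-tuple (measurableTypeR R) of z.1 :: z.2].
have mcons : measurable_fun setT cons_t by exact: measurable_cons.
apply: (measurable_fun_fubini_tonelli_F (f \o cons_t)) => //.
  exact: (measurableT_comp mf mcons).
by move=> z; exact: f0.
Qed.

End lebesgue_tuple.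

(** * The Gaussian on the line: standardisation, rotations of the plane, convolution *)

Section gauss.
Local Open Scope ereal_scope.
Context {R : realType}.
Local Notation mu := (@lebesgue_measure R).

Lemma measurable_affine (m s : R) : measurable_fun setT (fun z : R => m + s * z)%R.
Proof. by apply: measurable_funD. Qed.

Lemma measurable_linear2 (s t : R) :
  measurable_fun [set: measurableTypeR R * measurableTypeR R] (fun z => s * z.1 + t * z.2)%R.
Proof. by apply: measurable_funD; apply: measurable_funM. Qed.

Definition gauss_pdf : R -> R := normal_pdf 0 1.

Lemma gauss_pdfE z : gauss_pdf z = (normal_peak 1 * expR (- (z ^+ 2 / 2)))%R.
Proof.
rewrite /gauss_pdf normal_pdfE ?oner_eq0// /normal_fun subr0 expr1n.
by rewrite mulNr.
Qed.

Lemma gauss_pdf_ge0 z : (0 <= gauss_pdf z)%R.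
Proof. exact: normal_pdf_ge0. Qed.

Lemma measurable_gauss_pdf : measurable_fun setT gauss_pdf.
Proof. exact: measurable_normal_pdf. Qed.

(** The product of the two densities depends only on the squared norm of the point, which rotations
    preserve. *)
Lemma gauss_pdf_rot (c s x y : R) : (c ^+ 2 + s ^+ 2 = 1)%R ->
  (gauss_pdf (c * x + s * y) * gauss_pdf (c * y - s * x) = gauss_pdf x * gauss_pdf y)%R.
Proof.
move=> cs; rewrite !gauss_pdfE mulrACA [RHS]mulrACA -!expRD; congr (_ * expR _)%R.
rewrite -!opprD -!mulrDl; congr (- (_ / _))%R.
transitivity ((c ^+ 2 + s ^+ 2) * (x ^+ 2 + y ^+ 2))%R; last by rewrite cs mul1r.
by ring.
Qed.

(** The factor [s] is the Jacobian of the standardising substitution [x = m + s * z]. *)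
Lemma normal_pdf_affine (m s z : R) : (0 < s)%R ->
  (s * normal_pdf m s (m + s * z) = gauss_pdf z)%R.
Proof.
move=> s0; rewrite normal_pdfE ?gt_eqF// gauss_pdfE mulrA; congr (_ * expR _)%R.
  rewrite /normal_peak expr1n mul1r -[(_ * pi *+ 2)%R]mulrnAr sqrtrM ?sqr_ge0//.
  by rewrite sqrtr_sqr gtr0_norm// invfM mulrA divff ?gt_eqF// mul1r.
rewrite addrC addKr -[(_ *+ 2)%R]mulr_natr.
by field; rewrite gt_eqF.
Qed.

(* The mean of [f] under the normal law of mean [m] and standard deviation [s];
   unlike [normal_prob], it makes [s = 0] the point mass at [m]. *)
Definition gauss_mean (m s : R) (f : R -> \bar R) :=
  \int[mu]_z (f (m + s * z)%R * (gauss_pdf z)%:E).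

Lemma ge0_integral_normal_pdf (m s : R) (f : R -> \bar R) : (0 < s)%R ->
  measurable_fun setT f -> (forall x, 0 <= f x) ->
  \int[mu]_x (f x * (normal_pdf m s x)%:E) = gauss_mean m s f.
Proof.
move=> s0 mf f0.
have mg : measurable_fun setT (fun x => f x * (normal_pdf m s x)%:E).
  by apply: emeasurable_funM; [exact: mf|apply/measurable_EFinP; exact: measurable_normal_pdf].
have g0 x : 0 <= f x * (normal_pdf m s x)%:E.
  by rewrite mule_ge0// lee_fin normal_pdf_ge0.
rewrite -(ge0_integral_lebesgue_affine m s0 mg g0) -ge0_integralZl//; last 2 first.
- exact: (measurableT_comp mg (measurable_affine _ _)).
- by rewrite lee_fin ltW.
by apply: eq_integral => x _; rewrite muleCA -EFinM normal_pdf_affine.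
Qed.

Lemma integral_gauss_pdf : \int[mu]_z (gauss_pdf z)%:E = 1.
Proof. exact: integral_normal_pdf. Qed.

Lemma gauss_mean_cst (m s : R) (k : \bar R) : 0 <= k -> gauss_mean m s (cst k) = k.
Proof.
move=> k0; rewrite /gauss_mean ge0_integralZl//.
- by rewrite integral_gauss_pdf mule1.
- by apply/measurable_EFinP; exact: measurable_gauss_pdf.
- by move=> x _; rewrite lee_fin gauss_pdf_ge0.
Qed.

(** The rotation is the composite [s1 \o s2 \o s1] of shears, each of which translates one
    coordinate by a multiple of the other. *)
Lemma ge0_integral_lebesgue_rot (c s : R) (f : R * R -> \bar R) :
  (0 <= c)%R -> (c ^+ 2 + s ^+ 2 = 1)%R ->
  measurable_fun [set: measurableTypeR R * measurableTypeR R] f -> (forall z, 0 <= f z) ->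
  \int[mu \x mu]_z f (c * z.1 + s * z.2, c * z.2 - s * z.1)%R =
  \int[mu \x mu]_z f z.
Proof.
(* [tau] is the tangent of half the angle; [0 <= c] keeps its denominator positive. *)
move=> c0 cs mf f0; pose tau := (s / (1 + c))%R.
have c1 : (1 + c != 0)%R by rewrite gt_eqF// ltr_wpDr.
pose plane := (measurableTypeR R * measurableTypeR R)%type.
pose s1 (z : plane) : plane :=
  (z.1 + tau * z.2, z.2)%R.
pose s2 (z : plane) : plane :=
  (z.1, z.2 + - s * z.1)%R.
have ms1 : measurable_fun setT (fun z : plane => z.1 + tau * z.2)%R.
  by apply: measurable_funD => //; exact: measurable_funM.
have ms2 : measurable_fun setT (fun z : plane => z.2 + - s * z.1)%R.
  by apply: measurable_funD => //; exact: measurable_funM.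
have ms1' : measurable_fun setT s1 by exact: measurable_fun_pair.
have ms2' : measurable_fun setT s2 by exact: measurable_fun_pair.
have E1 (g : plane -> \bar R) : measurable_fun setT g -> (forall z, 0 <= g z) ->
    \int[mu \x mu]_z g (s1 z) = \int[mu \x mu]_z g z.
  move=> mg g0.
  apply: (@ge0_integral_shear1 _ _ _ _ _ mu mu (fun y x => x + tau * y)%R) => // y h mh h0.
  exact: ge0_integral_lebesgue_shift.
have E2 (g : plane -> \bar R) : measurable_fun setT g -> (forall z, 0 <= g z) ->
    \int[mu \x mu]_z g (s2 z) = \int[mu \x mu]_z g z.
  move=> mg g0.
  apply: (@ge0_integral_shear2 _ _ _ _ _ mu mu (fun x y => y + - s * x)%R) => // y h mh h0.
  exact: ge0_integral_lebesgue_shift.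
apply: etrans (E1 f mf f0).
apply: etrans (E2 (f \o s1) (measurableT_comp mf ms1') (fun z => f0 _)).
apply: etrans (E1 (f \o s1 \o s2) (measurableT_comp (measurableT_comp mf ms1') ms2')
  (fun z => f0 _)).
apply: eq_integral => -[x y] _ /=; congr f; rewrite /s1 /s2/=.
have t1 : (1 - s * tau = c)%R.
  rewrite /tau; apply: (mulIf c1); rewrite mulrBl -[(s * _ * _)%R]mulrA divfK// mul1r.
  by rewrite -expr2 -[(s ^+ 2)%R](addKr (c ^+ 2)%R) cs; ring.
have t2 : (tau * (1 + c) = s)%R by rewrite divfK.
congr pair.
  transitivity ((1 - s * tau) * x + tau * (1 + (1 - s * tau)) * y)%R; last by ring.
  by rewrite t1 t2.
transitivity ((1 - s * tau) * y - s * x)%R; last by ring.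
by rewrite t1.
Qed.

(* The standard Gaussian on the plane is invariant under the rotation that turns
   [s1 * x + s2 * y] into a multiple of the second coordinate. *)
Lemma gauss_mean_conv (s1 s2 : R) (f : R -> \bar R) : (0 <= s2)%R ->
  measurable_fun setT f -> (forall x, 0 <= f x) ->
  gauss_mean 0 s1 (fun x => gauss_mean x s2 f) =
  gauss_mean 0 (Num.sqrt (s1 ^+ 2 + s2 ^+ 2)) f.
Proof.
move=> s20 mf f0.
(* The rotation below divides by [S]. When [S] vanishes so do [s1] and [s2], and both sides equal
   [f 0]. *)
have [S0|S0] := eqVneq (s1 ^+ 2 + s2 ^+ 2)%R 0%R.
  move/eqP: S0; rewrite paddr_eq0 ?sqr_ge0// !sqrf_eq0 => /andP[/eqP-> /eqP->].
  rewrite expr0n/= addr0 sqrtr0 /gauss_mean.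
  under eq_integral do under eq_integral do rewrite mul0r addr0 mul0r addr0.
  under [RHS]eq_integral do rewrite mul0r addr0.
  have E (k : \bar R) : 0 <= k -> \int[mu]_z (k * (gauss_pdf z)%:E) = k.
    by move=> k0; have := gauss_mean_cst 0 0 k0.
  by rewrite !E.
have S_gt0 : (0 < s1 ^+ 2 + s2 ^+ 2)%R by rewrite lt_neqAle eq_sym S0 addr_ge0 ?sqr_ge0.
set S : R := Num.sqrt _.
have S_pos : (0 < S)%R by rewrite sqrtr_gt0.
have S2 : (S ^+ 2 = s1 ^+ 2 + s2 ^+ 2)%R by rewrite sqr_sqrtr ?ltW.
have mgau : measurable_fun setT (EFin \o gauss_pdf).
  apply/measurable_EFinP; exact: measurable_gauss_pdf.
pose F (z : measurableTypeR R * measurableTypeR R) : \bar R :=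
  f (0 + S * z.2)%R * ((gauss_pdf z.1)%:E * (gauss_pdf z.2)%:E).
pose F' (z : measurableTypeR R * measurableTypeR R) : \bar R :=
  f (s1 * z.1 + s2 * z.2)%R * ((gauss_pdf z.1)%:E * (gauss_pdf z.2)%:E).
have F0 z : 0 <= F z by rewrite !mule_ge0// lee_fin gauss_pdf_ge0.
have F'0 z : 0 <= F' z by rewrite !mule_ge0// lee_fin gauss_pdf_ge0.
have mgg : measurable_fun setT (fun z : measurableTypeR R * measurableTypeR R =>
    ((gauss_pdf z.1)%:E * (gauss_pdf z.2)%:E)).
  apply: emeasurable_funM.
    by apply: (measurableT_comp mgau); exact: measurable_fst.
  by apply: (measurableT_comp mgau); exact: measurable_snd.
have mF : measurable_fun setT F.
  apply: emeasurable_funM; last exact: mgg.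
  apply: (measurableT_comp mf); exact: (measurableT_comp (measurable_affine 0 S) measurable_snd).
have mF' : measurable_fun setT F'.
  apply: emeasurable_funM; last exact: mgg.
  apply: (measurableT_comp mf); exact: measurable_linear2.
transitivity (\int[mu \x mu]_z F' z).
  rewrite (fubini_tonelli1 F')//; apply: eq_integral => x _.
  rewrite /fubini_F/= /gauss_mean -ge0_integralZr//; first last.
  - by rewrite lee_fin gauss_pdf_ge0.
  - by move=> y _; rewrite mule_ge0// lee_fin gauss_pdf_ge0.
  - apply: emeasurable_funM; last exact: mgau.
    exact: (measurableT_comp mf (measurable_affine _ _)).
  apply: eq_integral => y _; rewrite /F'/= add0r -muleA.
  by rewrite [in RHS]muleC (muleC (gauss_pdf x)%:E) muleC.
transitivity (\int[mu \x mu]_z F z).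
  (* With cosine [s2 / S] and sine [- (s1 / S)], the second rotated coordinate times [S] is
     [s1 * x + s2 * y]; [0 <= s2] makes the cosine nonnegative, as the three shears require. *)
  have cs : ((s2 / S) ^+ 2 + (- (s1 / S)) ^+ 2 = 1)%R.
    by rewrite sqrrN !expr_div_n -mulrDl addrC -S2 divff// expf_neq0// gt_eqF.
  have c0 : (0 <= s2 / S)%R by rewrite divr_ge0// ltW.
  apply: etrans (ge0_integral_lebesgue_rot c0 cs mF F0).
  apply: eq_integral => -[x y] _; rewrite /F /F'/=; congr (_ * _).
    congr f; rewrite add0r mulNr opprK mulrDr addrC.
    by field; rewrite gt_eqF.
  rewrite -[LHS]EFinM -[RHS]EFinM; congr EFin.
  exact: (esym (gauss_pdf_rot x y cs)).
rewrite (fubini_tonelli2 F)//; apply: eq_integral => y _; rewrite /fubini_G/= /F/=.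
under eq_integral do rewrite muleCA.
rewrite ge0_integralZr//.
- by rewrite integral_gauss_pdf mul1e.
- by move=> x _; rewrite lee_fin gauss_pdf_ge0.
- by rewrite mule_ge0// lee_fin gauss_pdf_ge0.
Qed.

Lemma measurable_gauss_mean (s : R) (f : R -> \bar R) :
  measurable_fun setT f -> (forall x, 0 <= f x) ->
  measurable_fun setT (fun m => gauss_mean m s f).
Proof.
move=> mf f0.
pose F (z : measurableTypeR R * measurableTypeR R) : \bar R :=
  f (1 * z.1 + s * z.2)%R * (gauss_pdf z.2)%:E.
have mF : measurable_fun setT F.
  apply: emeasurable_funM.
    by apply: (measurableT_comp mf); exact: measurable_linear2.
  by apply/measurable_EFinP; exact: (measurableT_comp measurable_gauss_pdf).
have F0 z : 0 <= F z by rewrite mule_ge0// lee_fin gauss_pdf_ge0.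
have := measurable_fun_fubini_tonelli_F (m2 := mu) F mF F0.
apply: eq_measurable_fun => x _; rewrite /fubini_F /F/=.
by apply: eq_integral => y _; rewrite mul1r.
Qed.

Lemma gauss_mean_ge0 (m s : R) (f : R -> \bar R) : (forall x, 0 <= f x) ->
  0 <= gauss_mean m s f.
Proof.
by move=> f0; apply: integral_ge0 => z _; rewrite mule_ge0// lee_fin gauss_pdf_ge0.
Qed.

Lemma gauss_mean_indic (m s : R) (A : set R) : (0 < s)%R ->
  measurable (A : set (measurableTypeR R)) ->
  gauss_mean m s (fun x => (\1_A x)%:E) = normal_prob m s A.
Proof.
move=> s0 mA; rewrite -ge0_integral_normal_pdf//; last first.
  by apply/measurable_EFinP; exact: measurable_indic.
rewrite /normal_prob [RHS]integral_mkcond; apply: eq_integral => x _.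
by rewrite patchE indicE; case: ifPn => _; rewrite ?(mul1e, mul0e).
Qed.

Lemma gauss_mean0 (m : R) (f : R -> \bar R) : 0 <= f m -> gauss_mean m 0 f = f m.
Proof.
move=> fm; rewrite -[RHS](gauss_mean_cst 0 0 fm) /gauss_mean.
by apply: eq_integral => z _; rewrite mul0r addr0.
Qed.

(** * Linear forms in independent normal variables *)

Definition normal_pdf_tuple n (m s : 'I_n -> R) (t : n.-tuple (measurableTypeR R)) : R :=
  (\prod_(k < n) normal_pdf (m k) (s k) (tnth t k))%R.

Lemma normal_pdf_tuple_ge0 n (m s : 'I_n -> R) t : (0 <= normal_pdf_tuple m s t)%R.
Proof. by apply: prodr_ge0 => k _; exact: normal_pdf_ge0. Qed.

Lemma measurable_normal_pdf_tuple n (m s : 'I_n -> R) :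
  measurable_fun setT (normal_pdf_tuple m s).
Proof.
apply: measurable_prod => k _.
exact: (measurableT_comp (measurable_normal_pdf _ _) (measurable_tnth k)).
Qed.

Lemma measurable_tuple_lin n (m a : 'I_n -> R) :
  measurable_fun setT (fun t : n.-tuple (measurableTypeR R) =>
    \sum_(k < n) a k * (tnth t k - m k))%R.
Proof.
apply: measurable_sum => k; apply: measurable_funM => //.
by apply: measurable_funB => //; exact: measurable_tnth.
Qed.

(** Induction on [n]: at a fixed first coordinate the tail contributes a Gaussian of variance [S2],
    and [gauss_mean_conv] adds to it the variance of the first term. Zero coefficients are harmless,
    since [gauss_mean] allows standard deviation [0]. *)
Lemma gauss_mean_tuple n (m s a : 'I_n -> R) (f : R -> \bar R) :
  (forall k, (0 < s k)%R) -> measurable_fun setT f -> (forall x, 0 <= f x) ->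
  \int[lebesgue_tuple R n]_t
    (f (\sum_(k < n) a k * (tnth t k - m k))%R * (normal_pdf_tuple m s t)%:E) =
  gauss_mean 0 (Num.sqrt (\sum_(k < n) (a k * s k) ^+ 2)) f.
Proof.
have mint n' (m' s' a' : 'I_n' -> R) f' : measurable_fun setT f' ->
    measurable_fun setT (fun t : n'.-tuple (measurableTypeR R) =>
    f' (\sum_(k < n') a' k * (tnth t k - m' k))%R * (normal_pdf_tuple m' s' t)%:E).
  move=> mf'; apply: emeasurable_funM.
    exact: (measurableT_comp mf' (measurable_tuple_lin _ _)).
  by apply/measurable_EFinP; exact: measurable_normal_pdf_tuple.
elim: n => [|n IH] in m s a f *; move=> s0 mf f0.
  rewrite big_ord0 sqrtr0 gauss_mean0//.
  rewrite integral_dirac//; last exact: mint.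
  by rewrite diracT mul1e big_ord0 /normal_pdf_tuple big_ord0 mule1.
rewrite ge0_integral_lebesgue_tupleS; [|exact: mint|]; last first.
  by move=> t; rewrite mule_ge0// lee_fin normal_pdf_tuple_ge0.
rewrite big_ord_recl; set S2 := (\sum_(i < n) _)%R.
have S20 : (0 <= S2)%R by apply: sumr_ge0 => i _; exact: sqr_ge0.
pose S : R := Num.sqrt S2.
have SE : (S ^+ 2 = S2)%R by rewrite sqr_sqrtr.
(* [h x] is the integral over the tail when the first coordinate is [x]. *)
pose h x := gauss_mean (- (a ord0 * m ord0) + a ord0 * x)%R S f.
have mh : measurable_fun setT h.
  exact: (measurableT_comp (measurable_gauss_mean S mf f0) (measurable_affine _ _)).
transitivity (\int[mu]_x (h x * (normal_pdf (m ord0) (s ord0) x)%:E)).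
  apply: eq_integral => x _.
  have mf1 : measurable_fun setT (fun y : R => f (a ord0 * (x - m ord0) + 1 * y)%R).
    exact: (measurableT_comp mf (measurable_affine _ _)).
  have hE : h x = gauss_mean 0 S (fun y : R => f (a ord0 * (x - m ord0) + 1 * y)%R).
    apply: eq_integral => z _; congr (f _ * _).
    by ring.
  have /= IHx := IH (fun k => m (lift ord0 k)) (fun k => s (lift ord0 k))
    (fun k => a (lift ord0 k)) _ (fun k => s0 _) mf1 (fun y => f0 _).
  rewrite hE -IHx -ge0_integralZr//; first last.
  - by rewrite lee_fin normal_pdf_ge0.
  - by move=> t _; rewrite mule_ge0// lee_fin normal_pdf_tuple_ge0.
  - exact: (mint _ _ _ _ _ mf1).
  apply: eq_integral => t _; rewrite -muleA -EFinM; congr (f _ * _%:E).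
    rewrite big_ord_recl tnth0 mul1r; congr (_ + _)%R.
    by apply: eq_bigr => k _; rewrite tnthS.
  rewrite /normal_pdf_tuple big_ord_recl tnth0 mulrC; congr (_ * _)%R.
  by apply: eq_bigr => k _; rewrite tnthS.
rewrite ge0_integral_normal_pdf//; last by move=> x; exact: gauss_mean_ge0.
rewrite -SE; apply: etrans (gauss_mean_conv (a ord0 * s ord0)%R (sqrtr_ge0 S2) mf f0).
apply: eq_integral => z _; congr (_ * _); rewrite /h; congr (gauss_mean _ _ f).
by rewrite add0r mulrDr mulrA addKr.
Qed.

(** * The second moment of the standard Gaussian *)

Lemma is_derive_mul_gauss_pdf (z : R) :
  is_derive z 1%R (fun x => x * gauss_pdf x)%R ((1 - z ^+ 2) * gauss_pdf z)%R.
Proof.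
rewrite (_ : (fun x => _) = fun x => x * (normal_peak 1 * expR (- (x ^+ 2 / 2))))%R; last first.
  by apply/funext => x; rewrite gauss_pdfE.
rewrite gauss_pdfE.
apply: is_derive_eq.
by rewrite /GRing.scale/=; field.
Qed.

Lemma continuous_gauss_pdf : continuous gauss_pdf.
Proof. by apply: continuous_normal_pdf; rewrite oner_eq0. Qed.

(** The bound [1 + y <= expR y] at [y = x ^+ 2 / 2] squeezes the function under a multiple of
    [x^-1]. *)
Lemma cvg_mul_gauss_pdf : (fun x : R => x * gauss_pdf x)%R x @[x --> +oo%R] --> (0 : R)%R.
Proof.
have P0 : (0 <= normal_peak 1 :> R)%R by exact: normal_peak_ge0.
apply: (@squeeze_cvgr _ _ _ _ (cst 0%R) (fun x => (2 * normal_peak 1) * x^-1)%R).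
- near=> x.
  have x0 : (0 < x)%R by near: x; exact: nbhs_pinfty_gt.
  rewrite mulr_ge0 ?gauss_pdf_ge0 ?(ltW x0)//= gauss_pdfE.
  have xE : (x * expR (- (x ^+ 2 / 2)) <= 2 / x)%R.
    rewrite expRN ler_pdivlMr// mulrAC ler_pdivrMr ?expR_gt0//.
    have := expR_ge1Dx (x ^+ 2 / 2).
    by rewrite -expr2; lra.
  have := ler_wpM2l P0 xE.
  by rewrite (mulrCA (normal_peak 1) x) (mulrCA (normal_peak 1) 2%R) [(2 * (_ * _))%R]mulrA.
- exact: cvg_cst.
- rewrite -[X in _ --> X](mulr0 (2 * normal_peak 1)%R).
  apply: cvgM; first exact: cvg_cst.
  by apply/gtr0_cvgV0; [exact: nbhs_pinfty_gt|exact: cvg_id].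
Unshelve. all: by end_near. Qed.

(* As [z * gauss_pdf z] is a primitive of [(1 - z ^+ 2) * gauss_pdf z], which
   changes sign at [1], the half-line is cut at [1] to integrate functions of
   constant sign only. *)
Lemma integral_sqr_gauss_pdf : \int[mu]_z (z ^+ 2 * gauss_pdf z)%:E = 1.
Proof.
have csqr : continuous (fun z : R => z ^+ 2 * gauss_pdf z)%R.
  move=> z; apply: cvgM; first exact: exprn_continuous.
  exact: continuous_gauss_pdf.
have even_pdf : gauss_pdf =1 gauss_pdf \o -%R.
  by move=> z /=; rewrite !gauss_pdfE sqrrN.
have sqr_ge0' z : (0 <= z ^+ 2 * gauss_pdf z)%R by rewrite mulr_ge0 ?sqr_ge0 ?gauss_pdf_ge0.
rewrite ge0_symfun_integralT//; last by move=> z /=; rewrite sqrrN [in LHS]even_pdf.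
(* The value [1] is written as the mass of the density, so that two integrals over the half-line are
   compared. *)
rewrite -integral_gauss_pdf ge0_symfun_integralT//; last 2 first.
- exact: gauss_pdf_ge0.
- exact: continuous_gauss_pdf.
congr (_ * _).
have U : [set x : R | (0 <= x)%R] = `[0%R, 1%R] `|` `]1%R, +oo[.
  rewrite -itv_bndbnd_setU ?bnd_simp//.
  by apply/seteqP; split => x /=; rewrite in_itv/= ?andbT.
have disj : [disjoint `[0%R, 1%R]%classic & `](1%R : R), +oo[%classic].
  apply/disj_setPS => x [] /=; rewrite !in_itv/= andbT => /andP[_ x1].
  by rewrite ltNge x1.
have splitE (g : R -> R) : continuous g -> (forall x, 0 <= g x)%R ->
    \int[mu]_(x in [set x : R | (0 <= x)%R]) (g x)%:E =
    \int[mu]_(x in `[0%R, 1%R]) (g x)%:E + \int[mu]_(x in `]1%R, +oo[) (g x)%:E.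
  move=> cg g0; rewrite U ge0_integral_setU//.
  - apply: measurable_funTS; apply/measurable_EFinP.
    exact: continuous_measurable_fun.
  - by move=> x _; rewrite lee_fin.
rewrite !splitE//; last 2 first.
- exact: continuous_gauss_pdf.
- exact: gauss_pdf_ge0.
have mg (D : set R) : measurable_fun D (EFin \o gauss_pdf).
  by apply: measurable_funTS; apply/measurable_EFinP; exact: measurable_gauss_pdf.
have msq (D : set R) : measurable_fun D (fun z : R => (z ^+ 2 * gauss_pdf z)%:E).
  apply: measurable_funTS; apply/measurable_EFinP; exact: continuous_measurable_fun.
have cF : continuous (fun x : R => x * gauss_pdf x)%R.
  by move=> x; apply: cvgM; [exact: cvg_id|exact: continuous_gauss_pdf].
have cp : continuous (fun x : R => (1 - x ^+ 2) * gauss_pdf x)%R.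
  move=> x; apply: cvgM; last exact: continuous_gauss_pdf.
  by apply: cvgB; [exact: cvg_cst|exact: exprn_continuous].
have cq : continuous (fun x : R => (x ^+ 2 - 1) * gauss_pdf x)%R.
  move=> x; apply: cvgM; last exact: continuous_gauss_pdf.
  by apply: cvgB; [exact: exprn_continuous|exact: cvg_cst].
have I1 : \int[mu]_(x in `[0%R, 1%R]) ((1 - x ^+ 2) * gauss_pdf x)%:E =
    (gauss_pdf 1)%:E.
  rewrite (@continuous_FTC2 _ _ (fun x => x * gauss_pdf x)%R)//.
  - by rewrite mul1r mul0r sube0.
  - exact: continuous_subspaceT.
  - split; [|exact/cvg_at_right_filter/cF|exact/cvg_at_left_filter/cF].
    by move=> x _; have [] := is_derive_mul_gauss_pdf x.
  - by move=> x _; rewrite derive1E; have [_] := is_derive_mul_gauss_pdf x.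
have I2 : \int[mu]_(x in `]1%R, +oo[) ((x ^+ 2 - 1) * gauss_pdf x)%:E =
    (gauss_pdf 1)%:E.
  rewrite integral_itv_obnd_cbnd; last first.
    apply: measurable_funTS; apply/measurable_EFinP; exact: continuous_measurable_fun.
  rewrite (@ge0_continuous_FTC2y _ _ (fun x => - (x * gauss_pdf x))%R _ 0%R)//.
  - by rewrite mul1r EFinN oppeK add0e.
  - move=> x x1; rewrite mulr_ge0 ?gauss_pdf_ge0// subr_ge0.
    by rewrite exprn_ege1.
  - exact: continuous_subspaceT.
  - by rewrite -[X in _ --> X]oppr0; apply: cvgN; exact: cvg_mul_gauss_pdf.
  - by move=> x _; apply: derivableN; have [] := is_derive_mul_gauss_pdf x.
  - by apply: cvgN; exact/cvg_at_right_filter/cF.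
  - move=> x _; rewrite derive1E deriveN; last by have [] := is_derive_mul_gauss_pdf x.
    by have [_ ->] := is_derive_mul_gauss_pdf x; ring.
have A1 : \int[mu]_(x in `[0%R, 1%R]) (gauss_pdf x)%:E =
    \int[mu]_(x in `[0%R, 1%R]) (x ^+ 2 * gauss_pdf x)%:E + (gauss_pdf 1)%:E.
  rewrite -I1 -ge0_integralD//.
  - by apply: eq_integral => x _; rewrite -EFinD; congr EFin; ring.
  - by move=> x _; rewrite lee_fin.
  - exact: msq.
  - move=> x; rewrite /= in_itv/= => /andP[x0 x1].
    by rewrite lee_fin mulr_ge0 ?gauss_pdf_ge0// subr_ge0 exprn_ile1.
  - by apply: measurable_funTS; apply/measurable_EFinP; exact: continuous_measurable_fun.
have A2 : \int[mu]_(x in `]1%R, +oo[) (x ^+ 2 * gauss_pdf x)%:E =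
    \int[mu]_(x in `]1%R, +oo[) (gauss_pdf x)%:E + (gauss_pdf 1)%:E.
  rewrite -I2 -ge0_integralD//.
  - by apply: eq_integral => x _; rewrite -EFinD; congr EFin; ring.
  - by move=> x _; rewrite lee_fin gauss_pdf_ge0.
  - exact: mg.
  - move=> x; rewrite /= in_itv/= andbT => x1.
    by rewrite lee_fin mulr_ge0 ?gauss_pdf_ge0// subr_ge0 exprn_ege1// ltW.
  - by apply: measurable_funTS; apply/measurable_EFinP; exact: continuous_measurable_fun.
(* The second moment falls short of the mass by [gauss_pdf 1] on [[0, 1]] and exceeds it by the same
   amount beyond [1]. *)
by rewrite A1 A2 addeAC addeA.
Qed.

Lemma gauss_mean_sqr (s : R) : gauss_mean 0 s (fun x => (x ^+ 2)%:E) = (s ^+ 2)%:E.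
Proof.
rewrite /gauss_mean.
transitivity (\int[mu]_z ((s ^+ 2)%:E * (z ^+ 2 * gauss_pdf z)%:E)).
  by apply: eq_integral => z _; rewrite -!EFinM; congr EFin; ring.
rewrite ge0_integralZl ?integral_sqr_gauss_pdf ?mule1// ?lee_fin ?sqr_ge0//.
- apply/measurable_EFinP; apply: measurable_funM => //; exact: measurable_gauss_pdf.
- by move=> x _; rewrite lee_fin mulr_ge0 ?sqr_ge0 ?gauss_pdf_ge0.
Qed.

End gauss.

(** * Rotations of phase space and their invariance of volume *)

Section phase_flow.
Local Open Scope ereal_scope.
Context {R : realType} {N : nat}.
Variables (om b : 'I_N -> R).
Hypothesis om_gt0 : forall k, (0 < om k)%R.
Local Notation vec := (N.-tuple (measurableTypeR R)).
Local Notation vol := (lebesgue_tuple R N \x lebesgue_tuple R N).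

Lemma measurable_mktuple d (T : measurableType d) n (f : 'I_n -> T -> measurableTypeR R) :
  (forall k, measurable_fun setT (f k)) ->
  measurable_fun setT (fun x => [tuple f k x | k < n]).
Proof.
move=> mf; apply/measurable_fun_tnthP => k.
rewrite (_ : _ \o _ = f k)//.
by apply/funext => x /=; rewrite tnth_mktuple.
Qed.

Lemma measurable_tnth_fst (k : 'I_N) :
  measurable_fun [set: phase_space R N] (fun z => tnth z.1 k).
Proof. exact: (measurableT_comp (measurable_tnth k) measurable_fst). Qed.

Lemma measurable_tnth_snd (k : 'I_N) :
  measurable_fun [set: phase_space R N] (fun z => tnth z.2 k).
Proof. exact: (measurableT_comp (measurable_tnth k) measurable_snd). Qed.

(* Rotates each plane (om k * (x k - b k), v k) by the angle with cosine c k
   and sine s k. *)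
Definition phase_rot (c s : 'I_N -> R) (z : phase_space R N) : phase_space R N :=
  ([tuple b k + (c k * (tnth z.1 k - b k) + s k / om k * tnth z.2 k) | k < N],
   [tuple c k * tnth z.2 k - s k * om k * (tnth z.1 k - b k) | k < N])%R.

Lemma measurable_phase_rot c s : measurable_fun setT (phase_rot c s).
Proof.
have m1 k : measurable_fun [set: phase_space R N] (fun z => tnth z.1 k - b k)%R.
  by apply: measurable_funB => //; exact: measurable_tnth_fst.
apply: measurable_fun_pair; apply: measurable_mktuple => k.
  apply: measurable_funD => //; apply: measurable_funD; apply: measurable_funM => //.
  exact: measurable_tnth_snd.
apply: measurable_funB; apply: measurable_funM => //.
exact: measurable_tnth_snd.
Qed.

(* A plane rotation of cosine [c <> -1] is a product of three shears, and shears
   preserve Lebesgue measure by Tonelli and translation invariance. *)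
Lemma ge0_integral_phase_rot_half c s (f : phase_space R N -> \bar R) :
  (forall k, 0 <= c k)%R -> (forall k, c k ^+ 2 + s k ^+ 2 = 1)%R ->
  measurable_fun setT f -> (forall z, 0 <= f z) ->
  \int[vol]_z f (phase_rot c s z) = \int[vol]_z f z.
Proof.
move=> c0 cs mf f0; pose tau k := (s k / (1 + c k))%R.
have c1 k : (1 + c k != 0)%R by rewrite gt_eqF// ltr_wpDr.
(* [a1] and [a2] are the translation vectors of the shears: each block is shifted by a function of
   the other. The factors [om k] come from the plane coordinates [om k * (x k - b k)]. *)
pose a1 (v : vec) : vec := [tuple tau k / om k * tnth v k | k < N]%R.
pose a2 (x : vec) : vec := [tuple - (s k * om k * (tnth x k - b k)) | k < N]%R.
have ma1 : measurable_fun setT a1.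
  apply: measurable_mktuple => k; apply: measurable_funM => //; exact: measurable_tnth.
have ma2 : measurable_fun setT a2.
  apply: measurable_mktuple => k; apply: measurableT_comp => //.
  apply: measurable_funM => //; apply: measurable_funB => //; exact: measurable_tnth.
pose s1 (z : phase_space R N) : phase_space R N := (add_tuple (a1 z.2) z.1, z.2).
pose s2 (z : phase_space R N) : phase_space R N := (z.1, add_tuple (a2 z.1) z.2).
have ms1 : measurable_fun setT (fun z : phase_space R N => add_tuple (a1 z.2) z.1).
  by apply: measurable_add_tuple => //; exact: (measurableT_comp ma1 measurable_snd).
have ms2 : measurable_fun setT (fun z : phase_space R N => add_tuple (a2 z.1) z.2).
  by apply: measurable_add_tuple => //; exact: (measurableT_comp ma2 measurable_fst).
have ms1' : measurable_fun setT s1 by exact: measurable_fun_pair.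
have ms2' : measurable_fun setT s2 by exact: measurable_fun_pair.
have E1 h : measurable_fun setT h -> (forall z, 0 <= h z) ->
    \int[vol]_z h (s1 z) = \int[vol]_z h z.
  move=> mh h0.
  apply: (@ge0_integral_shear1 _ _ _ _ _ _ _ (fun v x => add_tuple (a1 v) x)) => //.
  by move=> v h' mh' h'0; exact: ge0_integral_lebesgue_tuple_shift.
have E2 h : measurable_fun setT h -> (forall z, 0 <= h z) ->
    \int[vol]_z h (s2 z) = \int[vol]_z h z.
  move=> mh h0.
  apply: (@ge0_integral_shear2 _ _ _ _ _ _ _ (fun x v => add_tuple (a2 x) v)) => //.
  by move=> v h' mh' h'0; exact: ge0_integral_lebesgue_tuple_shift.
apply: etrans (E1 f mf f0).
apply: etrans (E2 (f \o s1) (measurableT_comp mf ms1') (fun z => f0 _)).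
apply: etrans (E1 (f \o s1 \o s2) (measurableT_comp (measurableT_comp mf ms1') ms2')
  (fun z => f0 _)).
apply: eq_integral => -[x v] _ /=; congr f; rewrite /s1 /s2/=.
have t1 k : (1 - s k * tau k = c k)%R.
  rewrite /tau; apply: (mulIf (c1 k)); rewrite mulrBl -[(s k * _ * _)%R]mulrA divfK// mul1r.
  by rewrite -expr2 -[(s k ^+ 2)%R](addKr (c k ^+ 2)%R) cs; ring.
have t2 k : (tau k * (1 + c k) = s k)%R by rewrite divfK.
have omN k : (om k != 0)%R by rewrite gt_eqF.
congr pair; apply: eq_from_tnth => k; rewrite !tnth_mktuple /=.
  transitivity (b k + ((1 - s k * tau k) * (tnth x k - b k) +
      tau k * (1 + (1 - s k * tau k)) / om k * tnth v k))%R; first by rewrite t1 t2.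
  by field.
transitivity ((1 - s k * tau k) * tnth v k - s k * om k * (tnth x k - b k))%R; first by rewrite t1.
by field.
Qed.

(* A half angle with nonnegative cosine always exists, so every rotation is the
   square of one that splits into shears. *)
Lemma half_angle (t : R) : exists c s : R,
  [/\ (0 <= c)%R, (c ^+ 2 + s ^+ 2 = 1)%R, cos t = (c ^+ 2 - s ^+ 2)%R & sin t = (c * s *+ 2)%R].
Proof.
have tE : t = ((t / 2) *+ 2)%R by rewrite -mulr_natr divfK.
have ct : cos t = (cos (t / 2) ^+ 2 - sin (t / 2) ^+ 2)%R.
  by rewrite {1}tE mulr2n cosD -!expr2.
have st : sin t = (cos (t / 2) * sin (t / 2) *+ 2)%R.
  by rewrite {1}tE mulr2n sinD mulrC -mulr2n.
have [c0|c0] := leP 0%R (cos (t / 2)).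
  by exists (cos (t / 2)), (sin (t / 2)); split=> //; exact: cos2Dsin2.
exists (- cos (t / 2))%R, (- sin (t / 2))%R; rewrite !sqrrN mulrNN; split=> //.
  by rewrite oppr_ge0 ltW.
exact: cos2Dsin2.
Qed.

Lemma phase_rot_square c s z : (forall k, c k ^+ 2 + s k ^+ 2 = 1)%R ->
  phase_rot c s (phase_rot c s z) =
  phase_rot (fun k => c k ^+ 2 - s k ^+ 2)%R (fun k => c k * s k *+ 2)%R z.
Proof.
move=> cs; have omN k : (om k != 0)%R by rewrite gt_eqF.
by congr pair; apply: eq_from_tnth => k; rewrite !tnth_mktuple; field.
Qed.

Lemma ge0_integral_phase_rot (t : 'I_N -> R) (f : phase_space R N -> \bar R) :
  measurable_fun setT f -> (forall z, 0 <= f z) ->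
  \int[vol]_z f (phase_rot (cos \o t) (sin \o t) z) = \int[vol]_z f z.
Proof.
move=> mf f0.
have [c /choice[s cs]] := choice (fun k => half_angle (t k)).
have c0 k : (0 <= c k)%R by have [] := cs k.
have cs1 k : (c k ^+ 2 + s k ^+ 2 = 1)%R by have [] := cs k.
rewrite -[RHS](ge0_integral_phase_rot_half c0 cs1)//.
apply: etrans (ge0_integral_phase_rot_half c0 cs1
  (measurableT_comp mf (measurable_phase_rot _ _)) (fun z => f0 _)).
apply: eq_integral => z _ /=; rewrite phase_rot_square//; congr f.
by congr (phase_rot _ _ z); apply/funext => k /=; have [] := cs k.
Qed.

End phase_flow.

(** * The Gibbs law: rotation invariance and the law of linear forms *)

Section gibbs.
Local Open Scope ereal_scope.
Context {R : realType} {N : nat}.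
Variables (g om : 'I_N -> R) (kT q0 p0 : R).
Hypotheses (om_gt0 : forall k, (0 < om k)%R) (kT_gt0 : (0 < kT)%R).
Local Notation vol := (lebesgue_tuple R N \x lebesgue_tuple R N).

(** The minimum of the potential of oscillator [k] with the slow mode at [q0], and the mean of [x k]
    under the Gibbs law. *)
Definition rest_position (k : 'I_N) : R := (g k / om k ^+ 2 * q0)%R.

Definition boltzmann_weight (z : phase_space R N) : R :=
  expR (- hamiltonian g om q0 p0 (tnth z.1) (tnth z.2) / kT).

Lemma measurable_boltzmann_weight : measurable_fun setT boltzmann_weight.
Proof.
apply: measurableT_comp => //; apply: measurable_funM => //; apply: measurableT_comp => //.
apply: measurable_funD => //; apply: measurable_sum => k; apply: measurable_funD.
  by apply: measurable_funM => //; apply: measurable_funX; exact: measurable_tnth_snd.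
apply: measurable_funM => //; apply: measurable_funM => //; apply: measurable_funX.
by apply: measurable_funB => //; exact: measurable_tnth_fst.
Qed.

(** The energy of oscillator [k] is half the squared norm in its rotation plane, so each oscillator
    may be turned by its own angle [t k]. *)
Lemma boltzmann_weight_phase_rot t z :
  boltzmann_weight (phase_rot om rest_position (cos \o t) (sin \o t) z) = boltzmann_weight z.
Proof.
rewrite /boltzmann_weight; congr (expR (- _ / kT))%R; rewrite /hamiltonian; congr (_ + _)%R.
apply: eq_bigr => k _; rewrite !tnth_mktuple /= /rest_position.
have omN : (om k != 0)%R by rewrite gt_eqF.
have := cos2Dsin2 (t k); set c := cos _; set s := sin _ => cs.
transitivity ((c ^+ 2 + s ^+ 2) * (tnth z.2 k ^+ 2 / 2 + om k ^+ 2 *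
  (tnth z.1 k - g k / om k ^+ 2 * q0) ^+ 2 / 2))%R; first by field.
by rewrite cs mul1r.
Qed.

Lemma normal_pdf_tupleE n (m s : 'I_n -> R) t : (forall k, (s k != 0)%R) ->
  normal_pdf_tuple m s t = ((\prod_(k < n) normal_peak (s k)) *
    expR (\sum_(k < n) - (tnth t k - m k) ^+ 2 / (s k ^+ 2 *+ 2)))%R.
Proof.
move=> s0; rewrite /normal_pdf_tuple expR_sum -big_split/=.
by apply: eq_bigr => k _; rewrite normal_pdfE.
Qed.

(** The exponent is a sum of squares, one for each bath variable, so the weight factors into normal
    densities and the bath data become independent. *)
Lemma boltzmann_weightE : exists2 K : R, (0 < K)%R & forall z, boltzmann_weight z =
  (K * (normal_pdf_tuple rest_position (fun k => Num.sqrt kT / om k) z.1 *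
        normal_pdf_tuple (fun _ => 0) (fun _ => Num.sqrt kT) z.2))%R.
Proof.
have skT : (Num.sqrt kT != 0)%R by rewrite gt_eqF// sqrtr_gt0.
have omN k : (om k != 0)%R by rewrite gt_eqF.
pose P1 : R := (\prod_(k < N) normal_peak (Num.sqrt kT / om k))%R.
pose P2 : R := (\prod_(k < N) normal_peak (Num.sqrt kT))%R.
have P1_gt0 : (0 < P1)%R.
  by apply: prodr_gt0 => k _; rewrite normal_peak_gt0// mulf_neq0 ?invr_neq0.
have P2_gt0 : (0 < P2)%R by apply: prodr_gt0 => k _; rewrite normal_peak_gt0.
(* The constant carries the kinetic energy of the slow mode and removes the peaks of the normal
   densities. *)
exists (expR (- (p0 ^+ 2 / 2) / kT) / (P1 * P2))%R.
  by rewrite divr_gt0 ?expR_gt0 ?mulr_gt0.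
move=> z; rewrite !normal_pdf_tupleE//; last by move=> k; rewrite mulf_neq0 ?invr_neq0.
rewrite [X in (_ * X)%R]mulrACA -/P1 -/P2 [RHS]mulrA divfK ?mulf_neq0 ?gt_eqF// -!expRD.
rewrite /boltzmann_weight; congr expR; rewrite /hamiltonian opprD mulrDl; congr (_ + _)%R.
rewrite -big_split/= -sumrN mulr_suml; apply: eq_bigr => k _.
rewrite expr_div_n sqr_sqrtr ?ltW// /rest_position subr0.
by field; rewrite omN gt_eqF.
Qed.

Section gibbs_expectation.
Context d (Omega : measurableType d) (P : probability Omega R).
Variable Z : {RV P >-> phase_space R N}.
Hypothesis gibbsZ : gibbs_law g om kT q0 p0 (distribution P Z).

Lemma gibbs_expectation : exists2 c : R, (0 <= c)%R &
  forall f : phase_space R N -> \bar R, measurable_fun setT f -> (forall z, 0 <= f z) ->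
  \int[P]_w f (Z w) = c%:E * \int[vol]_z (f z * (boltzmann_weight z)%:E).
Proof.
have [c cE] := gibbsZ.
have mw : measurable_fun setT (EFin \o boltzmann_weight).
  by apply/measurable_EFinP; exact: measurable_boltzmann_weight.
have w0 z : 0 <= (boltzmann_weight z)%:E by rewrite lee_fin expR_ge0.
(* With a negative [c] the whole space would have nonpositive mass instead of mass [1]. *)
have c0 : (0 <= c)%R.
  rewrite leNgt; apply/negP => c_lt0.
  have := cE setT measurableT; rewrite probability_setT => /esym cI.
  suff : (1 <= 0 :> \bar R) by rewrite lee_fin ler10.
  by rewrite -cI; apply: mule_le0_ge0; [rewrite lee_fin ltW|exact: integral_ge0].
exists c => // f mf f0.
rewrite -(ge0_integral_distribution Z mf f0).
have mcw : measurable_fun setT (fun z => c * boltzmann_weight z)%R.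
  by apply: measurable_funM => //; exact: measurable_boltzmann_weight.
rewrite (ge0_integral_density (mu := vol) mcw _ _ mf f0); last 2 first.
- by move=> z; rewrite mulr_ge0// expR_ge0.
- move=> A mA; apply: etrans (cE A mA) _; rewrite -ge0_integralZl ?lee_fin//.
  exact: measurable_funTS.
rewrite -ge0_integralZl ?lee_fin//.
- by apply: eq_integral => z _; rewrite EFinM muleCA.
- exact: emeasurable_funM.
- by move=> z _; rewrite mule_ge0.
Qed.

Lemma gibbs_phase_rot t (f : phase_space R N -> \bar R) :
  measurable_fun setT f -> (forall z, 0 <= f z) ->
  \int[P]_w f (phase_rot om rest_position (cos \o t) (sin \o t) (Z w)) =
  \int[P]_w f (Z w).
Proof.
move=> mf f0; have [c c0 cE] := gibbs_expectation.
have mrot := measurable_phase_rot om rest_position (cos \o t) (sin \o t).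
have mw : measurable_fun setT (EFin \o boltzmann_weight).
  by apply/measurable_EFinP; exact: measurable_boltzmann_weight.
rewrite (cE _ mf f0); apply: etrans (cE _ (measurableT_comp mf mrot) (fun z => f0 _)) _.
congr (_ * _).
have mfw : measurable_fun setT (fun z => f z * (boltzmann_weight z)%:E).
  exact: emeasurable_funM.
have fw0 z : 0 <= f z * (boltzmann_weight z)%:E by rewrite mule_ge0// lee_fin expR_ge0.
apply: etrans _ (ge0_integral_phase_rot rest_position om_gt0 t mfw fw0).
by apply: eq_integral => z _; rewrite boltzmann_weight_phase_rot.
Qed.

(** Positions and velocities are independent normal blocks: [gauss_mean_tuple] handles each block
    and [gauss_mean_conv] adds the two variances. *)
Lemma gibbs_linear (al be : 'I_N -> R) (f : R -> \bar R) :
  measurable_fun setT f -> (forall x, 0 <= f x) ->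
  \int[P]_w f (\sum_(k < N) al k * (tnth (Z w).1 k - rest_position k) +
               \sum_(k < N) be k * tnth (Z w).2 k)%R =
  gauss_mean 0 (Num.sqrt (kT * \sum_(k < N) ((al k / om k) ^+ 2 + be k ^+ 2))) f.
Proof.
have [c c0 cE] := gibbs_expectation.
have [K K0 KE] := boltzmann_weightE.
pose b0 (_ : 'I_N) : R := 0%R.
pose sx k := (Num.sqrt kT / om k)%R; pose sv (_ : 'I_N) := Num.sqrt kT.
have sx0 k : (0 < sx k)%R by rewrite divr_gt0 ?sqrtr_gt0.
have sv0 k : (0 < sv k)%R by rewrite sqrtr_gt0.
pose Sx := (\sum_(k < N) (al k * sx k) ^+ 2)%R.
pose Sv := (\sum_(k < N) (be k * sv k) ^+ 2)%R.
have Sx_ge0 : (0 <= Sx)%R by apply: sumr_ge0 => k _; exact: sqr_ge0.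
have Sv_ge0 : (0 <= Sv)%R by apply: sumr_ge0 => k _; exact: sqr_ge0.
have SE : (kT * \sum_(k < N) ((al k / om k) ^+ 2 + be k ^+ 2) =
    Num.sqrt Sx ^+ 2 + Num.sqrt Sv ^+ 2)%R.
  rewrite !sqr_sqrtr// -big_split/= mulr_sumr; apply: eq_bigr => k _.
  rewrite /sx /sv mulrDr !exprMn sqr_sqrtr ?ltW//.
  by field; rewrite gt_eqF.
pose lin (z : phase_space R N) := (\sum_(k < N) al k * (tnth z.1 k - rest_position k) +
               \sum_(k < N) be k * (tnth z.2 k - b0 k))%R.
have mlin : measurable_fun setT lin.
  apply: measurable_funD; first exact: (measurableT_comp (measurable_tuple_lin _ _) measurable_fst).
  exact: (measurableT_comp (measurable_tuple_lin _ _) measurable_snd).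
(* Stated for every [h], because the normalisation [cK] uses it with the constant [1] before it is
   applied to [f]. *)
have volE (h : R -> \bar R) : measurable_fun setT h -> (forall x, 0 <= h x) ->
    \int[vol]_z (h (lin z) * (boltzmann_weight z)%:E) =
    K%:E * gauss_mean 0 (Num.sqrt (kT * \sum_(k < N) ((al k / om k) ^+ 2 + be k ^+ 2))) h.
  move=> mh h0.
  pose F (z : phase_space R N) := h (lin z) *
    ((normal_pdf_tuple rest_position sx z.1)%:E * (normal_pdf_tuple b0 sv z.2)%:E).
  have mF : measurable_fun setT F.
    apply: emeasurable_funM; first exact: (measurableT_comp mh mlin).
    apply: emeasurable_funM; apply/measurable_EFinP.
      exact: (measurableT_comp (measurable_normal_pdf_tuple _ _) measurable_fst).
    exact: (measurableT_comp (measurable_normal_pdf_tuple _ _) measurable_snd).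
  have F0 z : 0 <= F z by rewrite !mule_ge0// lee_fin normal_pdf_tuple_ge0.
  transitivity (K%:E * \int[vol]_z F z).
    rewrite -ge0_integralZl ?lee_fin ?(ltW K0)//.
    by apply: eq_integral => z _; rewrite KE EFinM EFinM muleCA.
  congr (_ * _); apply: etrans (fubini_tonelli1 F mF F0) _.
  (* Read backwards, [gauss_mean_conv] splits off the velocity variance [Sv], and the position part
     becomes the outer Tonelli integral. *)
  rewrite SE -gauss_mean_conv ?sqrtr_ge0// -(gauss_mean_tuple rest_position al sx0); last 2 first.
  - exact: measurable_gauss_mean.
  - by move=> x; exact: gauss_mean_ge0.
  apply: eq_integral => x _; rewrite /fubini_F/=.
  set A := (\sum_(k < N) al k * _)%R.
  have mA : measurable_fun setT (fun y : R => h (A + 1 * y)%R).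
    exact: (measurableT_comp mh (measurable_affine _ _)).
  rewrite (_ : gauss_mean A _ h =
      gauss_mean 0 (Num.sqrt Sv) (fun y : R => h (A + 1 * y)%R)); last first.
    by apply: eq_integral => y _; congr (h _ * _); ring.
  rewrite -(gauss_mean_tuple b0 be sv0 mA)// -ge0_integralZr//; first last.
  - by rewrite lee_fin normal_pdf_tuple_ge0.
  - by move=> v _; rewrite mule_ge0// lee_fin normal_pdf_tuple_ge0.
  - apply: emeasurable_funM; last by apply/measurable_EFinP; exact: measurable_normal_pdf_tuple.
    exact: (measurableT_comp mA (measurable_tuple_lin _ _)).
  apply: eq_integral => v _; rewrite /F/= -muleA (muleC (normal_pdf_tuple b0 sv v)%:E).
  by rewrite mul1r.
(* The total mass of the law determines the normalisation. *)
have cK : c%:E * K%:E = 1.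
  have := cE (cst 1) (measurable_cst _) (fun=> lee01).
  have -> : \int[vol]_z (cst 1 z * (boltzmann_weight z)%:E) = K%:E.
    by rewrite (volE (cst 1))// gauss_mean_cst// mule1.
  move=> <-; transitivity (1 * P setT); last by rewrite mul1e; exact: probability_setT.
  exact: integral_cst.
move=> mf f0.
have := cE (f \o lin) (measurableT_comp mf mlin) (fun z => f0 _).
rewrite volE// muleA cK mul1e => <-.
apply: eq_integral => w _ /=; congr (f (_ + _)%R).
by apply: eq_bigr => k _; rewrite subr0.
Qed.

End gibbs_expectation.

End gibbs.

(** * The residual force as a process: Gaussianity, stationarity, covariance *)

Section processes.
Local Open Scope ereal_scope.
Context {R : realType} {N : nat}.
Variables (g om : 'I_N -> R) (kT q0 p0 : R).
Hypotheses (om_gt0 : forall k, (0 < om k)%R) (kT_gt0 : (0 < kT)%R).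
Context d (Omega : measurableType d) (P : probability Omega R).
Variable Z : {RV P >-> phase_space R N}.
Hypothesis gibbsZ : gibbs_law g om kT q0 p0 (distribution P Z).

Local Notation b := (rest_position g om q0).

Definition linear_form (al be : 'I_N -> R) (z : phase_space R N) : R :=
  (\sum_(k < N) al k * (tnth z.1 k - b k) + \sum_(k < N) be k * tnth z.2 k)%R.

(* The variance of [linear_form al be] under the Gibbs law: [x k] has variance
   [kT / om k ^+ 2] and [v k] has variance [kT]. *)
Definition form_variance (al be : 'I_N -> R) : R :=
  (kT * \sum_(k < N) ((al k / om k) ^+ 2 + be k ^+ 2))%R.

Lemma form_variance_ge0 al be : (0 <= form_variance al be)%R.
Proof.
by rewrite mulr_ge0 ?(ltW kT_gt0)//; apply: sumr_ge0 => k _; rewrite addr_ge0 ?sqr_ge0.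
Qed.

Lemma measurable_linear_form al be : measurable_fun setT (linear_form al be).
Proof.
apply: measurable_funD; apply: measurable_sum => k; apply: measurable_funM => //.
  by apply: measurable_funB => //; exact: measurable_tnth_fst.
exact: measurable_tnth_snd.
Qed.

Lemma measurable_linear_form_Z al be : measurable_fun setT (fun w => linear_form al be (Z w)).
Proof. exact: (measurableT_comp (measurable_linear_form al be) (measurable_funPT Z)). Qed.

Lemma probability_integral_indic d' (T : measurableType d') (Y : Omega -> T) (A : set T) :
  measurable_fun setT Y -> measurable A ->
  P [set w | A (Y w)] = \int[P]_w (\1_A (Y w))%:E.
Proof.
move=> mY mA; have mYA : measurable (Y @^-1` A).
  by rewrite -[X in measurable X]setTI; exact: mY.
have := integral_indic P measurableT mYA.
by rewrite setIT => <-; apply: eq_integral => w _; rewrite !indicE.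
Qed.

Lemma gaussian_linear_form al be :
  gaussian_variable P (fun w => linear_form al be (Z w)).
Proof.
split; first exact: measurable_linear_form_Z.
have lawE (A : set (measurableTypeR R)) : measurable A ->
    P ((fun w => linear_form al be (Z w)) @^-1` A) =
    gauss_mean 0 (Num.sqrt (form_variance al be)) (fun x => (\1_A x)%:E).
  move=> mA; rewrite -(gibbs_linear om_gt0 kT_gt0 gibbsZ al be); last 2 first.
  - by apply/measurable_EFinP; exact: measurable_indic.
  - by move=> x; rewrite lee_fin.
  by apply: (probability_integral_indic _ mA); exact: measurable_linear_form_Z.
(* A form of zero variance is almost surely [0] and falls under the point-mass case of
   [gaussian_variable]. *)
have [s0|s0] := eqVneq (Num.sqrt (form_variance al be)) 0%R.
  by left; exists 0%R => A mA; rewrite lawE// s0 gauss_mean0// lee_fin.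
right; exists 0%R, (Num.sqrt (form_variance al be)).
have s_gt0 : (0 < Num.sqrt (form_variance al be))%R by rewrite lt_neqAle eq_sym s0 sqrtr_ge0.
by split=> // A mA; rewrite lawE// gauss_mean_indic.
Qed.

Lemma residual_force_linear (z : phase_space R N) t :
  residual_force g om q0 (tnth z.1) (tnth z.2) t =
  linear_form (fun k => g k * cos (om k * t))%R (fun k => g k / om k * sin (om k * t))%R z.
Proof.
rewrite /residual_force /linear_form -big_split/=; apply: eq_bigr => k _.
rewrite /rest_position; set c := cos _; set s := sin _.
by field; rewrite gt_eqF.
Qed.

Lemma sum_linear_form n (a : 'I_n -> R) (al be : 'I_n -> 'I_N -> R) z :
  (\sum_(i < n) a i * linear_form (al i) (be i) z)%R =
  linear_form (fun k => \sum_(i < n) a i * al i k)%R (fun k => \sum_(i < n) a i * be i k)%R z.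
Proof.
rewrite /linear_form; under eq_bigr do rewrite mulrDr !mulr_sumr.
rewrite big_split/=; congr (_ + _)%R; rewrite exchange_big/=; apply: eq_bigr => k _.
  by rewrite mulr_suml; apply: eq_bigr => i _; rewrite mulrA.
by rewrite mulr_suml; apply: eq_bigr => i _; rewrite mulrA.
Qed.

Lemma gaussian_force : gaussian_process P (force_process g om q0 Z).
Proof.
move=> n t a; pose al i k := (g k * cos (om k * t i))%R.
pose be i k := (g k / om k * sin (om k * t i))%R.
rewrite (_ : (fun w => _) = fun w => linear_form (fun k => \sum_(i < n) a i * al i k)%R
   (fun k => \sum_(i < n) a i * be i k)%R (Z w)); first exact: gaussian_linear_form.
apply/funext => w; rewrite -sum_linear_form; apply: eq_bigr => i _.
by rewrite /force_process residual_force_linear.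
Qed.

Lemma residual_force_shift (z : phase_space R N) t h :
  residual_force g om q0 (tnth z.1) (tnth z.2) (t + h)%R =
  let z' := phase_rot om b (cos \o (fun k => om k * h)%R) (sin \o (fun k => om k * h)%R) z in
  residual_force g om q0 (tnth z'.1) (tnth z'.2) t.
Proof.
apply: eq_bigr => k _; rewrite !tnth_mktuple/= /rest_position [(om k * (t + h))%R]mulrDr cosD sinD.
set c := cos (_ * h); set s := sin (_ * h); set c1 := cos _; set s1 := sin _.
by field; rewrite gt_eqF.
Qed.

Lemma stationary_force : stationary_process P (force_process g om q0 Z).
Proof.
move=> n t h A mA.
pose G (z : phase_space R N) : n.-tuple (measurableTypeR R) :=
  [tuple residual_force g om q0 (tnth z.1) (tnth z.2) (t i) | i < n].
have mG : measurable_fun setT G.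
  apply: measurable_mktuple => i.
  rewrite (_ : (fun z => _) = linear_form (fun k => g k * cos (om k * t i))%R
    (fun k => g k / om k * sin (om k * t i))%R); first exact: measurable_linear_form.
  by apply/funext => z; rewrite residual_force_linear.
pose rot := phase_rot om b (cos \o (fun k => om k * h)%R) (sin \o (fun k => om k * h)%R).
have mrot : measurable_fun setT rot by exact: measurable_phase_rot.
have mGZ : measurable_fun setT (fun w => G (Z w)).
  exact: (measurableT_comp mG (measurable_funPT Z)).
have mGrZ : measurable_fun setT (fun w => G (rot (Z w))).
  exact: (measurableT_comp mG (measurableT_comp mrot (measurable_funPT Z))).
transitivity (P [set w | A (G (rot (Z w)))]).
  congr (P _); apply/seteqP; split => w /=; congr A; apply: eq_from_tnth => i;
  by rewrite !tnth_mktuple /force_process residual_force_shift.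
rewrite (probability_integral_indic mGrZ mA) (probability_integral_indic mGZ mA).
apply: (gibbs_phase_rot om_gt0 gibbsZ (fun k => om k * h)%R (f := fun z => (\1_A (G z))%:E)).
  apply/measurable_EFinP; exact: (measurableT_comp (measurable_indic mA) mG).
by move=> z; rewrite lee_fin.
Qed.

(* The law of a linear form is symmetric: the form with opposite coefficients
   has the same variance. *)
Lemma fine_expectation_linear_form al be :
  fine 'E_P[fun w => linear_form al be (Z w)] = 0%R.
Proof.
rewrite unlock integralE.
pose f (x : R) := (Num.max x 0)%:E.
have mf : measurable_fun setT f.
  by apply/measurable_EFinP; apply: measurable_maxr.
have f0 x : 0 <= f x by rewrite lee_fin le_max lexx orbT.
pose oal k := (- al k)%R; pose obe k := (- be k)%R.
have V : form_variance oal obe = form_variance al be.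
  by congr (_ * _)%R; apply: eq_bigr => k _; rewrite /oal /obe mulNr !sqrrN.
set x := (X in X - _); set y := (X in _ - X).
have -> : x = gauss_mean 0 (Num.sqrt (form_variance al be)) f.
  rewrite -(gibbs_linear om_gt0 kT_gt0 gibbsZ al be mf f0).
  by apply: eq_integral => w _; rewrite funeposE /f -EFin_max.
(* The negative part of a form is the positive part of the form with opposite coefficients. *)
have -> : y = gauss_mean 0 (Num.sqrt (form_variance al be)) f.
  rewrite -V -(gibbs_linear om_gt0 kT_gt0 gibbsZ oal obe mf f0).
  apply: eq_integral => w _; rewrite funenegE /f -EFinN -EFin_max; congr (Num.max _ _)%:E.
  rewrite opprD -!sumrN; congr (_ + _)%R; apply: eq_bigr => k _; by rewrite mulNr.
(* If the mean were infinite, [fine] would still send [+oo - +oo] to [0]. *)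
by case: gauss_mean => //= r; rewrite subrr.
Qed.

Lemma expectation_linear_form_sqr al be :
  \int[P]_w ((linear_form al be (Z w)) ^+ 2)%:E = (form_variance al be)%:E.
Proof.
rewrite -[in RHS](sqr_sqrtr (form_variance_ge0 al be)) -gauss_mean_sqr.
rewrite -(gibbs_linear om_gt0 kT_gt0 gibbsZ al be)//.
  by apply/measurable_EFinP; exact: measurable_funX.
by move=> x; rewrite lee_fin sqr_ge0.
Qed.

(* Polarization. *)
Lemma covariance_linear_form al be al' be' :
  covariance P (fun w => linear_form al be (Z w)) (fun w => linear_form al' be' (Z w)) =
  (kT * \sum_(k < N) (al k * al' k / om k ^+ 2 + be k * be' k))%:E.
Proof.
rewrite covariance.unlock !fine_expectation_linear_form expectation.unlock.
pose S w := linear_form (fun k => al k + al' k)%R (fun k => be k + be' k)%R (Z w).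
pose D w := linear_form (fun k => al k - al' k)%R (fun k => be k - be' k)%R (Z w).
have mS : measurable_fun setT (fun w => (S w ^+ 2)%:E).
  by apply/measurable_EFinP; apply: measurable_funX; exact: measurable_linear_form_Z.
have mD : measurable_fun setT (fun w => (D w ^+ 2)%:E).
  by apply/measurable_EFinP; apply: measurable_funX; exact: measurable_linear_form_Z.
(* Finite second moments make both squares integrable, so the integral of their difference may be
   split. *)
have iS : P.-integrable setT (fun w => (S w ^+ 2)%:E).
  apply/integrableP; split=> //.
  under eq_integral do rewrite /= ger0_norm ?sqr_ge0//.
  by rewrite expectation_linear_form_sqr ltry.
have iD : P.-integrable setT (fun w => (D w ^+ 2)%:E).
  apply/integrableP; split=> //.
  under eq_integral do rewrite /= ger0_norm ?sqr_ge0//.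
  by rewrite expectation_linear_form_sqr ltry.
transitivity (\int[P]_w ((4^-1)%:E * ((S w ^+ 2)%:E - (D w ^+ 2)%:E))).
  apply: eq_integral => w _; rewrite -EFinB -EFinM; congr EFin.
  rewrite -[LHS]/((linear_form al be (Z w) - 0) * (linear_form al' be' (Z w) - 0))%R !subr0.
  have -> : S w = (linear_form al be (Z w) + linear_form al' be' (Z w))%R.
    rewrite /S /linear_form addrACA -!big_split/=.
    by apply: eq_bigr => k _; ring.
  have -> : D w = (linear_form al be (Z w) - linear_form al' be' (Z w))%R.
    rewrite /D /linear_form opprD addrACA -!sumrN -!big_split/=.
    by apply: eq_bigr => k _; ring.
  by field.
rewrite integralZl//; last exact: integrableB.
rewrite integralB// !expectation_linear_form_sqr -EFinB -EFinM; congr EFin.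
rewrite /form_variance -mulrBr mulrCA -sumrB mulr_sumr; congr (_ * _)%R.
by apply: eq_bigr => k _; field; rewrite gt_eqF.
Qed.

(** At time [0] the velocity coefficients carry [sin 0], so only the position terms contribute, with
    weight [g k ^+ 2 / om k ^+ 2 * cos (om k * t)]. *)
Lemma covariance_force t :
  covariance P (force_process g om q0 Z t) (force_process g om q0 Z 0) =
  (kT * memory_kernel g om t)%:E.
Proof.
have E s : force_process g om q0 Z s = fun w =>
    linear_form (fun k => g k * cos (om k * s))%R (fun k => g k / om k * sin (om k * s))%R (Z w).
  by apply/funext => w; rewrite /force_process residual_force_linear.
rewrite !E covariance_linear_form; congr (_ * _)%:E; apply: eq_bigr => k _.
rewrite mulr0 cos0 sin0; set c := cos _; set s := sin _.
by field; rewrite gt_eqF.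
Qed.

End processes.

(** * Hamilton's equations and the generalized Langevin equation *)

Section hamilton.
Context {R : realType} {N : nat}.
Variables (g om : 'I_N -> R).
Hypothesis om_gt0 : forall k, 0 < om k.

Let omN k : om k != 0. Proof. by rewrite gt_eqF. Qed.

Lemma is_derive_hamiltonian_p (q p : R) (x v : 'I_N -> R) :
  is_derive p 1 (fun z => hamiltonian g om q z x v) p.
Proof.
rewrite /hamiltonian; set S := \sum_(k < N) _.
by apply: is_derive_eq; rewrite /GRing.scale/=; field.
Qed.

Lemma is_derive_hamiltonian_q (q p : R) (x v : 'I_N -> R) :
  is_derive q 1 (fun z => hamiltonian g om z p x v)
    (- \sum_(k < N) g k * (x k - g k / om k ^+ 2 * q)).
Proof.
rewrite (_ : (fun z => _) = cst (p ^+ 2 / 2) + \sum_(k < N) (fun z =>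
  v k ^+ 2 / 2 + om k ^+ 2 * (x k - g k / om k ^+ 2 * z) ^+ 2 / 2)); last first.
  by apply/funext => z; rewrite /hamiltonian fctE fct_sumE.
apply: is_derive_eq; rewrite add0r -sumrN; apply: eq_bigr => k _.
by rewrite /GRing.scale/=; field; rewrite omN.
Qed.

Lemma is_derive_hamiltonian_v (q p : R) (x v : 'I_N -> R) k :
  is_derive (v k) 1 (fun z => hamiltonian g om q p x [eta v with k |-> z]) (v k).
Proof.
(* The update at [k] touches only the [k]-th summand; the rest is isolated as a constant in [z]. *)
rewrite (_ : (fun z => _) = fun z => z ^+ 2 / 2 + (p ^+ 2 / 2 +
  (om k ^+ 2 * (x k - g k / om k ^+ 2 * q) ^+ 2 / 2 + \sum_(j < N | j != k)
  (v j ^+ 2 / 2 + om j ^+ 2 * (x j - g j / om j ^+ 2 * q) ^+ 2 / 2)))); last first.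
  apply/funext => z; rewrite /hamiltonian (bigD1 k)//= eqxx.
  rewrite (eq_bigr (fun j => v j ^+ 2 / 2 +
    om j ^+ 2 * (x j - g j / om j ^+ 2 * q) ^+ 2 / 2)); last by move=> j /negPf ->.
  by ring.
set A := p ^+ 2 / 2 + _.
by apply: is_derive_eq; rewrite /GRing.scale/=; field.
Qed.

Lemma is_derive_hamiltonian_x (q p : R) (x v : 'I_N -> R) k :
  is_derive (x k) 1 (fun z => hamiltonian g om q p [eta x with k |-> z] v)
    (om k ^+ 2 * (x k - g k / om k ^+ 2 * q)).
Proof.
rewrite (_ : (fun z => _) = fun z => om k ^+ 2 * (z - g k / om k ^+ 2 * q) ^+ 2 / 2 +
  (p ^+ 2 / 2 + (v k ^+ 2 / 2 + \sum_(j < N | j != k)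
  (v j ^+ 2 / 2 + om j ^+ 2 * (x j - g j / om j ^+ 2 * q) ^+ 2 / 2)))); last first.
  apply/funext => z; rewrite /hamiltonian (bigD1 k)//= eqxx.
  rewrite (eq_bigr (fun j => v j ^+ 2 / 2 +
    om j ^+ 2 * (x j - g j / om j ^+ 2 * q) ^+ 2 / 2)); last by move=> j /negPf ->.
  by ring.
set A := p ^+ 2 / 2 + _; set c := _ * q.
by apply: is_derive_eq; rewrite /GRing.scale/=; field.
Qed.

Variables (q p : R -> R) (x v : 'I_N -> R -> R).
Hypothesis motion : hamilton_equations g om q p x v.

Lemma hamilton_q (t : R) : is_derive t 1 q (p t).
Proof.
have [+ _ _ _] := motion t.
by rewrite derive1E; have [_ ->] := is_derive_hamiltonian_p (q t) (p t) (x ^~ t) (v ^~ t).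
Qed.

Lemma hamilton_p (t : R) :
  is_derive t 1 p (\sum_(k < N) g k * (x k t - g k / om k ^+ 2 * q t)).
Proof.
have [_ + _ _] := motion t; rewrite derive1E.
by have [_ ->] := is_derive_hamiltonian_q (q t) (p t) (x ^~ t) (v ^~ t); rewrite opprK.
Qed.

Lemma hamilton_x k (t : R) : is_derive t 1 (x k) (v k t).
Proof.
have [_ _ /(_ k) + _] := motion t.
by rewrite derive1E; have [_ ->] := is_derive_hamiltonian_v (q t) (p t) (x ^~ t) (v ^~ t) k.
Qed.

Lemma hamilton_v k (t : R) :
  is_derive t 1 (v k) (- (om k ^+ 2 * (x k t - g k / om k ^+ 2 * q t))).
Proof.
have [_ _ _ /(_ k)] := motion t.
by rewrite derive1E; have [_ ->] := is_derive_hamiltonian_x (q t) (p t) (x ^~ t) (v ^~ t) k.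
Qed.

(* The residual force when [s = 0], the actual bath force when [s = t]. *)
Definition frozen_force (t s : R) : R :=
  \sum_(k < N) g k * ((x k s - g k / om k ^+ 2 * q s) * cos (om k * (t - s)) +
                      v k s / om k * sin (om k * (t - s))).

(** The oscillator part of the motion cancels against the derivative of the angle [om k * (t - s)].
    Only the drift of the rest position, at speed [g k / om k ^+ 2 * p s], survives. *)
Lemma is_derive_frozen_force (t s : R) :
  is_derive s 1 (frozen_force t) (- (memory_kernel g om (t - s) * p s)).
Proof.
rewrite (_ : frozen_force t = \sum_(k < N) (fun s => g k *
    ((x k s - g k / om k ^+ 2 * q s) * cos (om k * (t - s)) +
     v k s / om k * sin (om k * (t - s))))); last first.
  by apply/funext => u; rewrite fct_sumE.
have dq := hamilton_q s.
have dx k := hamilton_x k s.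
have dv k := hamilton_v k s.
apply: is_derive_eq; rewrite /memory_kernel mulr_suml -sumrN; apply: eq_bigr => k _.
by rewrite /GRing.scale/=; field; rewrite omN.
Qed.

Lemma continuous_memory_kernel : continuous (memory_kernel g om).
Proof.
move=> t; apply/differentiable_continuous/derivable1_diffP.
suff [] : is_derive t 1 (memory_kernel g om)
  (\sum_(k < N) - (g k ^+ 2 / om k ^+ 2 * om k * sin (om k * t))) by [].
rewrite (_ : memory_kernel g om = \sum_(k < N) (fun s => g k ^+ 2 / om k ^+ 2 * cos (om k * s)));
  last by apply/funext => s; rewrite fct_sumE.
apply: is_derive_eq; apply: eq_bigr => k _.
by rewrite /GRing.scale/=; field; rewrite omN.
Qed.

Lemma generalized_langevin (t : R) : 0 <= t ->
  is_derive t 1 (q^`()%classic)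
    (- (\int[lebesgue_measure]_(s in `[0, t]) (memory_kernel g om (t - s) * q^`()%classic s)) +
     residual_force g om (q 0) (x ^~ 0) (fun k => (x k)^`()%classic 0) t).
Proof.
move=> t0.
have -> : q^`()%classic = p.
  by apply/funext => s; rewrite derive1E; have [_ ->] := hamilton_q s.
have -> : (fun k => (x k)^`()%classic 0) = v ^~ 0.
  by apply/funext => k; rewrite derive1E; have [_ ->] := hamilton_x k 0.
(* The acceleration is the actual bath force, so what remains is an identity between numbers
   relating [frozen_force t t] and [frozen_force t 0]. *)
apply: is_derive_eq; first exact: hamilton_p.
have Ft : frozen_force t t = \sum_(k < N) g k * (x k t - g k / om k ^+ 2 * q t).
  by apply: eq_bigr => k _; rewrite subrr mulr0 cos0 sin0 mulr1 mulr0 addr0.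
have F0 : frozen_force t 0 = residual_force g om (q 0) (x ^~ 0) (v ^~ 0) t.
  by apply: eq_bigr => k _; rewrite subr0.
have cp : continuous p.
  by move=> s; apply/differentiable_continuous/derivable1_diffP; have [] := hamilton_p s.
have cF : continuous (fun s => - frozen_force t s).
  move=> s; apply/differentiable_continuous/derivable1_diffP/derivableN.
  by have [] := is_derive_frozen_force t s.
have ck : continuous (fun s => memory_kernel g om (t - s) * p s).
  move=> s; apply: cvgM; last exact: cp.
  apply: (cvg_comp (fun s => t - s) (memory_kernel g om)); last exact: continuous_memory_kernel.
  by apply: cvgB; [exact: cvg_cst|exact: cvg_id].
rewrite -Ft -F0.
(* At [t = 0] the interval is a single point and is treated apart; the fundamental theorem is
   applied with [0 < t]. *)
move: t0; rewrite le_eqVlt => /predU1P[t0|t0].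
  by rewrite -t0 set_itv1 Rintegral_set1 oppr0 add0r.
rewrite /Rintegral (@continuous_FTC2 _ _ (fun s => - frozen_force t s))//=.
- by ring.
- exact: continuous_subspaceT.
- split; [|exact/cvg_at_right_filter/cF|exact/cvg_at_left_filter/cF].
  by move=> s _; apply: derivableN; have [] := is_derive_frozen_force t s.
- move=> s _; rewrite derive1E deriveN; last by have [] := is_derive_frozen_force t s.
  by have [_ ->] := is_derive_frozen_force t s; rewrite opprK.
Qed.

End hamilton.

(** * A density as a measure *)

Section density_measure.
Local Open Scope ereal_scope.
Context d (T : measurableType d) (R : realType).
Variables (mu : {measure set T -> \bar R}) (h : {mfun T >-> R}).
Hypothesis h0 : forall x, (0 <= h x)%R.

(* [h0] occurs in the body so that the measure structure declared below can be
   inferred from the head constant. *)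
Definition density_measure (A : set T) : \bar R :=
  let _ := h0 in \int[mu]_(x in A) (h x)%:E.

Let density_measure0 : density_measure set0 = 0.
Proof. by rewrite /density_measure integral_set0. Qed.

Let density_measure_ge0 A : 0 <= density_measure A.
Proof. by apply: integral_ge0 => x _; rewrite lee_fin. Qed.

Let density_measure_sigma_additive : semi_sigma_additive density_measure.
Proof.
move=> A mA tA mUA; rewrite /density_measure ge0_integral_bigcup//.
- apply: is_cvg_ereal_nneg_natsum_cond => n _ _.
  by apply: integral_ge0 => x _; rewrite lee_fin.
- by apply/measurable_funTS/measurable_EFinP; exact: measurable_funPT.
- by move=> x _; rewrite lee_fin.
Qed.

HB.instance Definition _ := isMeasure.Build _ _ _ density_measure
  density_measure0 density_measure_ge0 density_measure_sigma_additive.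

End density_measure.

(** * Weak convergence of the bath measures and the limit kernel *)

Section weak_limit.
Local Open Scope ereal_scope.
Context {R : realType}.

(** [bath_measure] is a bare set function; recognising it as a finite sum of scaled Dirac measures
    makes the integration rules for measures available. *)
Lemma ge0_integral_bath_measure N (g om : 'I_N -> R) (f : R -> \bar R) :
  measurable_fun setT f -> (forall x, 0 <= f x) ->
  \int[bath_measure g om]_x f x =
  \sum_(k < N) (pi / 2 * (g k ^+ 2 / om k ^+ 2))%:E * f (om k).
Proof.
move=> mf f0.
have c0 k : (0 <= pi / 2 * (g k ^+ 2 / om k ^+ 2) :> R)%R.
  by rewrite mulr_ge0 ?divr_ge0 ?pi_ge0 ?sqr_ge0.
(* [msum] takes a sequence indexed by [nat], so the family is extended by the zero measure beyond
   [N]. *)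
pose m n : {measure set (measurableTypeR R) -> \bar R} :=
  if insub n is Some k then mscale (NngNum (c0 k)) (@dirac _ (measurableTypeR R) (om k) R)
  else mzero.
have mE (k : 'I_N) : m k = mscale (NngNum (c0 k)) (@dirac _ (measurableTypeR R) (om k) R).
  by rewrite /m valK.
rewrite (_ : bath_measure g om = msum m N); last first.
  apply/funext => A; rewrite /bath_measure /msum/=.
  by apply: eq_bigr => k _; rewrite mE.
rewrite ge0_integral_measure_sum//; apply: eq_bigr => k _.
by rewrite mE ge0_integral_mscale// integral_dirac// diracT mul1e.
Qed.

Variable J : R -> R.
Hypotheses (J0 : forall w, (0 < w)%R -> (0 <= J w)%R)
  (iJ : lebesgue_measure.-integrable `]0%R, +oo[ (fun w => (J w / w)%:E)).

Lemma ge0_integral_spectral_measure (f : R -> R) :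
  continuous f -> (forall x, 0 <= f x)%R ->
  \int[spectral_measure J]_x (f x)%:E =
  \int[lebesgue_measure]_(w in `]0%R, +oo[) (f w * (J w / w))%:E.
Proof.
move=> cf f0.
have mf : measurable_fun setT (EFin \o f).
  by apply/measurable_EFinP; exact: continuous_measurable_fun.
(* Extension by zero makes the density nonnegative on the whole line, the sign of [J] being known
   only on the positive half-line. *)
pose h := ((fun w => J w / w) \_ `]0, +oo[)%R.
have mh : measurable_fun [set: measurableTypeR R] h.
  have /measurable_EFinP mJ := measurable_int _ iJ.
  exact: (measurable_restrictT _ (measurable_itv _)).1 mJ.
have h0 x : (0 <= h x)%R.
  rewrite /h patchE; case: ifPn => //; rewrite inE/= in_itv/= andbT => x0.
  by rewrite divr_ge0 ?J0// ltW.
pose hm : {mfun measurableTypeR R >-> R} := HB.pack h (isMeasurableFun.Build _ _ _ _ _ mh).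
have hm0 x : (0 <= hm x)%R := h0 x.
have -> : spectral_measure J = density_measure lebesgue_measure hm0.
  apply/funext => A; rewrite /spectral_measure integral_mkcondr.
  by apply: eq_integral => x _; rewrite /= /h !patchE; case: ifP.
rewrite (ge0_integral_density (mu := lebesgue_measure) mh h0 _ mf)//.
rewrite [RHS]integral_mkcond; apply: eq_integral => x _; rewrite /h !patchE.
by case: ifPn => _; rewrite ?mule0// EFinM.
Qed.

Lemma cvg_memory_kernel (g om : forall N : nat, 'I_N -> R) :
  weak_cvg (fun N => bath_measure (g N) (om N)) (spectral_measure J) ->
  forall t, memory_kernel (g N) (om N) t @[N --> \oo] --> limit_kernel J t.
Proof.
move=> wJ t.
pose u (f : R -> R) N : R := (\sum_(k < N) (pi / 2 * (g N k ^+ 2 / om N k ^+ 2)) * f (om N k))%R.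
(* [u f N] is the integral of [f] against the bath measure. The bounds [0] and [2] fit both test
   functions, [1] and [1 + cos (w * t)]. *)
have ucvg (f : R -> R) (l : R) : continuous f -> (forall x, 0 <= f x <= 2)%R ->
    \int[lebesgue_measure]_(w in `]0%R, +oo[) (f w * (J w / w))%:E = l%:E ->
    u f N @[N --> \oo] --> l.
  move=> cf f02 fl.
  have f0 x : (0 <= f x)%R by have /andP[] := f02 x.
  have := wJ f cf.
  rewrite ge0_integral_spectral_measure// fl => /(_ _)/fine_cvg H.
  have mf : measurable_fun setT (EFin \o f).
    by apply/measurable_EFinP; exact: continuous_measurable_fun.
  have Hb : exists M, forall x, (`|f x| <= M)%R.
    by exists 2%R => x; rewrite ger0_norm//; have /andP[] := f02 x.
  apply: cvg_trans (H Hb); apply: near_eq_cvg; near=> N => /=.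
  rewrite (ge0_integral_bath_measure _ _ (f := EFin \o f))//.
  by rewrite -[RHS]/(fine (u f N)%:E) /u -sumEFin; congr fine.
have ccos : continuous (fun w : R => cos (w * t)).
  move=> w; apply: (cvg_comp (fun w => w * t)%R cos); last exact: continuous_cos.
  by apply: cvgM; [exact: cvg_id|exact: cvg_cst].
have iJc : lebesgue_measure.-integrable `]0%R, +oo[ (fun w => (J w / w * cos (w * t))%:E).
  apply: le_integrable iJ => //.
    apply/measurable_EFinP; apply: measurable_funM.
      by have /measurable_EFinP := measurable_int _ iJ.
    by apply: measurable_funTS; exact: continuous_measurable_fun.
  move=> w _; rewrite /= lee_fin normrM ler_piMr// ler_norml.
  by rewrite cos_geN1 cos_le1.
pose a0 : R := (\int[lebesgue_measure]_(w in `]0, +oo[) (J w / w))%R.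
pose a1 : R := (\int[lebesgue_measure]_(w in `]0, +oo[) (J w / w * cos (w * t)))%R.
have u0 : u (cst 1%R) N @[N --> \oo] --> a0.
  apply: ucvg; [exact: cst_continuous|by move=> x; rewrite /=; lra|].
  rewrite /a0 /Rintegral fineK; last exact: integrable_fin_num.
  by apply: eq_integral => w _; rewrite /= mul1r.
have u1 : u (fun w => 1 + cos (w * t))%R N @[N --> \oo] --> (a0 + a1)%R.
  apply: ucvg.
  - by move=> w; apply: cvgD; [exact: cvg_cst|exact: ccos].
  - by move=> w; have := cos_geN1 (w * t); have := cos_le1 (w * t); lra.
  rewrite EFinD /a0 /a1 /Rintegral !fineK; [|exact: integrable_fin_num..].
  rewrite -integralD//; apply: eq_integral => w _.
  by rewrite -EFinD; congr EFin; ring.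
rewrite /limit_kernel -/a1 (_ : a1 = a0 + a1 - a0)%R; last by rewrite addrC addKr.
(* The cosine is recovered as the difference of the two test functions, and [2 / pi] undoes the
   factor [pi / 2] of the bath measure. *)
rewrite (_ : (fun N => _) = fun N => (2 / pi * (u (fun w => 1 + cos (w * t)) N - u (cst 1) N))%R).
  by apply: cvgM; [exact: cvg_cst|exact: cvgB].
apply/funext => N; rewrite /u -sumrB mulr_sumr; apply: eq_bigr => k _ /=.
have pi0 : pi != 0%R :> R by rewrite gt_eqF// pi_gt0.
by move: (g N k ^+ 2 / om N k ^+ 2)%R (cos (om N k * t))%R (pi : R) pi0 => c C p p0; field.
Unshelve. all: by end_near. Qed.

End weak_limit.

Theorem lemma1p1 (R : realType) :
  (forall (N : nat) (g om : 'I_N -> R), (forall k, 0 < om k) ->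
    (forall (q p : R -> R) (x v : 'I_N -> R -> R),
      hamilton_equations g om q p x v ->
      forall t : R, 0 <= t ->
        is_derive t 1 (q^`()%classic)
          (- (\int[lebesgue_measure]_(s in `[0, t])
                 (memory_kernel g om (t - s) * q^`()%classic s)) +
           residual_force g om (q 0) (x ^~ 0) (fun k => (x k)^`()%classic 0) t)) /\
    (forall kB T : R, 0 < kB -> 0 < T ->
      forall (q0 p0 : R) (d : measure_display) (Omega : measurableType d)
        (P : probability Omega R) (Z : {RV P >-> phase_space R N}),
      gibbs_law g om (kB * T) q0 p0 (distribution P Z) ->
      let eta := force_process g om q0 Z in
      [/\ stationary_process P eta,
          gaussian_process P eta &
          forall t : R, covariance P (eta t) (eta 0) =
            (kB * T * memory_kernel g om t)%:E])) /\
  (forall (g om : forall N : nat, 'I_N -> R) (J : R -> R),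
    (forall N k, 0 < om N k) ->
    (forall w, 0 < w -> 0 <= J w) ->
    lebesgue_measure.-integrable `]0%R, +oo[ (fun w => (J w / w)%:E) ->
    weak_cvg (fun N => bath_measure (g N) (om N)) (spectral_measure J) ->
    (forall t : R,
      memory_kernel (g N) (om N) t @[N --> \oo] --> limit_kernel J t) /\
    (forall kB T : R, 0 < kB -> 0 < T ->
      forall (q0 p0 : nat -> R) (d : nat -> measure_display)
        (Omega : forall N, measurableType (d N))
        (P : forall N, probability (Omega N) R)
        (Z : forall N, {RV (P N) >-> phase_space R N}),
      (forall N, gibbs_law (g N) (om N) (kB * T) (q0 N) (p0 N)
                   (distribution (P N) (Z N))) ->
      forall t : R,
        (((kB * T)^-1)%:E *
          covariance (P N) (force_process (g N) (om N) (q0 N) (Z N) t)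
                           (force_process (g N) (om N) (q0 N) (Z N) 0))%E
        @[N --> \oo] --> (limit_kernel J t)%:E)).
Proof.
split.
  move=> N g om om_gt0; split=>
    [q p x v motion t t0|kB T kB_gt0 T_gt0 q0 p0 d Omega P Z gibbsZ].
    exact: generalized_langevin.
  have kT_gt0 : 0 < kB * T by exact: mulr_gt0.
  split; first exact: (stationary_force om_gt0 gibbsZ).
    exact: (gaussian_force om_gt0 kT_gt0 gibbsZ).
  exact: (covariance_force om_gt0 kT_gt0 gibbsZ).
move=> g om J om_gt0 J0 iJ wJ; have cK := cvg_memory_kernel J0 iJ wJ.
split=> // kB T kB_gt0 T_gt0 q0 p0 d Omega P Z gibbsZ t.
have kT_gt0 : 0 < kB * T by exact: mulr_gt0.
(* At every finite [N] the normalised covariance is exactly the memory kernel, so its limit is the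
   one already found. *)
rewrite (_ : (fun N => _) = fun N => (memory_kernel (g N) (om N) t)%:E); last first.
  apply/funext => N.
  by rewrite (covariance_force (om_gt0 N) kT_gt0 (gibbsZ N)) -EFinM mulKf ?gt_eqF.
by apply: cvg_EFin; [exact: nearW|exact: cK].
Qed.
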